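(* Let $\mathbb{K}$ be a field of characteristic zero, $\mathcal{K}$ a non-empty set of finite groups, and $\ell : \mathbb{N}-\{0\} \to \mathbb{K}^\times$ a monoid homomorphism. The condition $S\cong S_{E,W}$ characterizes a bijective correspondence $[S]\leftrightarrow[E,W]$ between the isomorphism classes $[S]$ of simple $\Lambda$-modules $S$ and the equivalence classes $[E,W]$ of $\mathcal{S}$-seeds $(E,W)$ for $\mathcal{K}$.
   Context: Subgroups of direct products: for groups $F,G$, elements of $F\times G$ are written $f\times g$, and $\mathcal{S}(F,G)$ is the set of subgroups of $F\times G$. For $U\in\mathcal{S}(F,G)$, put $U_\bullet=\{g\in G: 1\times g\in U\}$ and ${}_\bullet U=\{f\in F: f\times 1\in U\}$. For $U\in\mathcal{S}(F,G)$, $V\in\mathcal{S}(G,H)$, the star product $U*V\in\mathcal{S}(F,H)$ is the subgroup of those $f\times h$ for which there exists $g\in G$ with $f\times g\in U$ and $g\times h\in V$. Put $\sigma(U,V)=\ell(|U_\bullet\cap{}_\bullet V|)$. For any set $\mathcal{K}$ of finite groups, the algebra $\Lambda=\Lambda_{\mathcal{K}}$ over $\mathbb{K}$ (not necessarily unital) has $\mathbb{K}$-basis consisting of formal symbols $s_U^{F,G}$ with $F,G\in\mathcal{K}$ and $U\in\mathcal{S}(F,G)$, with multiplication $s_U^{F,G}s_V^{G,H}=\sigma(U,V)\,s_{U*V}^{F,H}$, and $s_U^{F,G}s_V^{G',H}=0$ when $G\neq G'$. For $G\in\mathcal{K}$, $\mathrm{id}_G=s_{\Delta(G)}^{G,G}$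 with $\Delta(G)=\{g\times g:g\in G\}$, and $\mathrm{End}_\Lambda(G)=\mathrm{id}_G\,\Lambda\,\mathrm{id}_G$. In a $\Lambda$-module, every element is required to be fixed by some idempotent of $\Lambda$. For a $\Lambda$-module $M$, $M(G)=\mathrm{id}_G M$. A factor group of $R$ is a group isomorphic to a subquotient $M/N$ of $R$ ($R\geq M\unrhd N$); write $[S]\leq[R]$ when $S$ is a factor group of $R$. This is a partial order on isomorphism classes of finite groups. For $E \in \mathcal{K}$, $\mu_E:\mathbb{K}\mathrm{Aut}(E)\to\mathrm{End}_\Lambda(E)$ is the unital algebra monomorphism $\theta\mapsto s^{E,E}_{\Delta(\theta)}$, where $\Delta(\theta)=\{\theta(e)\times e: e\in E\}$, and $\mathrm{Res}^{\mu_E}$ is restriction along $\mu_E$. An $\mathcal{S}$-seed for $\mathcal{K}$ is a pair $(E,W)$ where $E$ is a factor group of an element of $\mathcal{K}$ and $W$ is a simple $\mathbb{K}\mathrm{Aut}(E)$-module. Seeds $(E,W)$ and $(E',W')$ are equivalent if there is a group isomorphism $\theta:E'\to E$ such that $W$ is isomorphic to the transport of $W'$ along the induced isomorphism $\mathbb{K}\mathrm{Aut}(E')\to\mathbb{K}\mathrm{Aut}(E)$. Definition of $S_{E,W}$: choose a set $\mathcal{K}'\supseteq\mathcal{K}$ of finite groups containing an isomorphic copy of every subquotient of every element of $\mathcal{K}'$, and let $\Lambda'=\Lambda_{\mathcal{K}'}\supseteq\Lambda$. Replacing $(E,W)$ by an equivalent seed, suppose $E\in\mathcal{K}'$. There is,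 up to isomorphism, a unique simple $\Lambda'$-module $S'$ such that $[E]$ is minimal subject to $S'(E)\neq0$ and such that $W\cong\mathrm{Res}^{\mu_E}(S'(E))$. Then $S_{E,W}=\Lambda S'$, which is a simple $\Lambda$-module, independent up to isomorphism of the choices. *)

(* Defs.v *)
From HB Require Import structures.
From mathcomp Require Import all_boot all_order all_algebra all_fingroup all_solvable.
From mathcomp Require Import finmap monalg.

Set Implicit Arguments.
Unset Strict Implicit.
Unset Printing Implicit Defensive.

Import GRing.Theory.
Local Open Scope ring_scope.

Section Subgroups.
Local Open Scope group_scope.

(** [slice_r U] and [slice_l U] are written U with a bullet as right,
    respectively left, subscript. *)
Definition slice_r (F G : finGroupType) (U : {group (F * G)%type}) : {set G} :=
  [set g | (1, g) \in U].

Definition slice_l (F G : finGroupType) (U : {group (F * G)%type}) : {set F} :=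
  [set f | (f, 1) \in U].

Definition star_set (F G H : finGroupType)
    (U : {group (F * G)%type}) (V : {group (G * H)%type}) : {set F * H} :=
  [set x | [exists g, ((x.1, g) \in U) && ((g, x.2) \in V)]].

Lemma star_group_set (F G H : finGroupType)
    (U : {group (F * G)%type}) (V : {group (G * H)%type}) :
  group_set (star_set U V).
Proof.
apply/group_setP; split=> [|x y].
  by rewrite inE; apply/existsP; exists 1; rewrite !group1.
rewrite !inE => /existsP[g /andP[Ug Vg]] /existsP[h /andP[Uh Vh]].
apply/existsP; exists (g * h).
by rewrite (groupM Ug Uh) (groupM Vg Vh).
Qed.

Definition star (F G H : finGroupType)
    (U : {group (F * G)%type}) (V : {group (G * H)%type}) : {group (F * H)%type} :=
  Group (star_group_set U V).

Definition Delta_set (G : finGroupType) : {set G * G} := [set (g, g) | g : G].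

Lemma Delta_group_set (G : finGroupType) : group_set (Delta_set G).
Proof.
apply/group_setP; split=> [|_ _ /imsetP[g _ ->] /imsetP[h _ ->]].
  by apply/imsetP; exists 1.
by apply/imsetP; exists (g * h).
Qed.

Definition Delta (G : finGroupType) : {group (G * G)%type} := Group (Delta_group_set G).

(** The product of [autg E] is that of permutations, [(a * b) e = b (a e)]:
    the composite [a \o b] is [b * a]. *)
Definition autg (E : finGroupType) : finGroupType := subg_of (Aut [set: E])%G.

Definition aut_fun (E : finGroupType) (a : autg E) : E -> E := sgval a.

Definition Delta_aut_set (E : finGroupType) (a : autg E) : {set E * E} := [set (aut_fun a e, e) | e : E].

Lemma Delta_aut_group_set (E : finGroupType) (a : autg E) : group_set (Delta_aut_set a).
Proof.
have aM : {morph aut_fun a : x y / x * y}.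
  have /morphicP aM := Aut_morphic (subgP a).
  by move=> x y; apply: aM; rewrite inE.
apply/group_setP; split=> [|_ _ /imsetP[g _ ->] /imsetP[h _ ->]].
  apply/imsetP; exists 1 => //; congr (_, _).
  by apply: (mulgI (aut_fun a 1)); rewrite -aM !mulg1.
by apply/imsetP; exists (g * h); rewrite // aM.
Qed.

Definition Delta_aut (E : finGroupType) (a : autg E) : {group (E * E)%type} :=
  Group (Delta_aut_group_set a).

Definition factor_group (S R : finGroupType) : Prop :=
  exists M N : {group R}, N <| M /\ [set: S] \isog M / N.

End Subgroups.

(** A set of finite groups is given as a family [K : I -> finGroupType] indexed
    by a choiceType; distinct indices count as distinct elements of the set, even
    when the groups they index coincide. *)

Definition subquotient_closed (I : choiceType) (K : I -> finGroupType) : Prop :=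
  forall (i : I) (M N : {group K i}), (N <| M)%g ->
  exists j : I, [set: K j] \isog (M / N)%g.

(** A set containing the set [K] is the union of [K] with some set [L]. *)
Definition extend (I J : choiceType) (K : I -> finGroupType)
    (L : J -> finGroupType) (x : I + J) : finGroupType :=
  match x with inl i => K i | inr j => L j end.

Record symb (I : choiceType) (K : I -> finGroupType) := Symb {
  symb_l : I;
  symb_r : I;
  symb_grp : {group (K symb_l * K symb_r)%type} }.

Section SymbChoice.
Context (I : choiceType) (K : I -> finGroupType).

Definition symb_code (s : symb K) :
    {p : I * I & {group (K p.1 * K p.2)%type}} :=
  Tagged (fun p : I * I => {group (K p.1 * K p.2)%type}) (i := (symb_l s, symb_r s))
    (symb_grp s).

Definition symb_decode (u : {p : I * I & {group (K p.1 * K p.2)%type}}) : symb K :=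
  Symb (tagged u).

Lemma symb_codeK : cancel symb_code symb_decode.
Proof. by case. Qed.

(* Opaque, as unfolding this instance makes unification in [malg] diverge. *)
Fact symb_hasDecEq : hasDecEq (symb K).
Proof. exact: (Choice.eqtype_hasDecEq_mixin (Choice.class (can_type symb_codeK))). Qed.
Fact symb_hasChoice : hasChoice (symb K).
Proof. exact: (Choice.choice_hasChoice_mixin (Choice.class (can_type symb_codeK))). Qed.
HB.instance Definition _ := symb_hasDecEq.
HB.instance Definition _ := symb_hasChoice.
End SymbChoice.

Section Algebra.
Context (k : fieldType) (l : nat -> k) (I : choiceType) (K : I -> finGroupType).

Definition sigma (F G H : finGroupType)
    (U : {group (F * G)%type}) (V : {group (G * H)%type}) : k :=
  l #|slice_r U :&: slice_l V|.

Definition lam : lmodType k := {malg k[symb K]}.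

Definition bas (i j : I) (U : {group (K i * K j)%type}) : lam := << Symb U >>.

Definition symb_mul (s t : symb K) : lam :=
  match symb_r s =P symb_l t with
  | ReflectT e =>
      let V := ecast i {group (K i * K (symb_r t))%type} (esym e) (symb_grp t) in
      sigma (symb_grp s) V *: bas (star (symb_grp s) V)
  | ReflectF _ => 0
  end.

Definition lam_mul (x y : lam) : lam :=
  \sum_(s <- msupp x) \sum_(t <- msupp y) (x@_s * y@_t) *: symb_mul s t.

Definition lam_id (i : I) : lam := bas (Delta (K i)).

(** The algebra need not have a unit (the family may be infinite); [lm_idem] replaces
    the unit axiom. *)
Record lamMod := LamMod {
  lm_car :> lmodType k;
  lm_act : lam -> lm_car -> lm_car;
  lm_linl : forall m : lm_car, linear (lm_act^~ m);
  lm_linr : forall x : lam, linear (lm_act x);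
  lm_actA : forall (x y : lam) (m : lm_car),
    lm_act (lam_mul x y) m = lm_act x (lm_act y m);
  lm_idem : forall m : lm_car, exists e : lam, lam_mul e e = e /\ lm_act e m = m }.

End Algebra.

Section Inclusion.
Context (k : fieldType) (I J : choiceType).
Context (K : I -> finGroupType) (L : J -> finGroupType).

Definition symb_incl (s : symb K) : symb (extend K L) :=
  @Symb _ (extend K L) (inl (symb_l s)) (inl (symb_r s)) (symb_grp s).

Definition lam_incl (x : lam k K) : lam k (extend K L) :=
  \sum_(s <- msupp x) x@_s *: << symb_incl s >>.
End Inclusion.

(** Simplicity of the vector space [V] with the operators [op t]. *)
Definition simple_op (k : fieldType) (T : Type) (V : lmodType k) (op : T -> V -> V) :=
  (exists v : V, v != 0) /\
  forall P : V -> Prop,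
    P 0 ->
    (forall (a : k) (u v : V), P u -> P v -> P (a *: u + v)) ->
    (forall (t : T) (v : V), P v -> P (op t v)) ->
  (forall v, P v -> v = 0) \/ (forall v, P v).

(** [f] is an isomorphism of vector spaces from [V] to the subspace [P] of [U]. *)
Definition iso_onto (k : fieldType) (V U : lmodType k) (P : U -> Prop)
    (f : {linear V -> U}) : Prop :=
  injective f /\ forall u : U, P u <-> exists v : V, u = f v.

Section Modules.
Context (k : fieldType) (l : nat -> k) (I : choiceType) (K : I -> finGroupType).

Definition lam_simple (S : lamMod l K) : Prop := simple_op (@lm_act _ _ _ _ S).

Definition lam_iso (S T : lamMod l K) : Prop :=
  exists f : {linear S -> T},
    bijective f /\ forall (x : lam k K) (m : S), f (lm_act x m) = lm_act x (f m).

(** Membership in the subspace [M(K i)]. *)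
Definition in_eval (M : lamMod l K) (i : I) (m : M) : Prop :=
  exists n : M, m = lm_act (lam_id k K i) n.

Definition eval_neq0 (M : lamMod l K) (i : I) : Prop :=
  exists m : M, in_eval i m /\ m != 0.

Definition minimal_at (M : lamMod l K) (i : I) : Prop :=
  eval_neq0 M i /\
  forall j : I, factor_group (K j) (K i) -> eval_neq0 M j ->
    [set: K j] \isog [set: K i].

Record simpleMod := SimpleMod {
  sm_mod :> lamMod l K;
  sm_simple : lam_simple sm_mod }.

End Modules.

(** Modules of the group algebra of [Aut(E)], as linear representations. *)
Record autMod (k : fieldType) (E : finGroupType) := AutMod {
  am_car :> lmodType k;
  am_act : autg E -> am_car -> am_car;
  am_lin : forall a : autg E, linear (am_act a);
  am_act1 : forall w : am_car, am_act 1%g w = w;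
  am_actM : forall (a b : autg E) (w : am_car),
    am_act (b * a)%g w = am_act a (am_act b w) }.

Definition aut_simple (k : fieldType) (E : finGroupType) (W : autMod k E) : Prop :=
  simple_op (@am_act _ _ W).

(** The condition on [a] and [b] says that [b] is [theta \o a \o theta^-1]. *)
Definition seed_equiv (k : fieldType) (E E' : finGroupType)
    (W : autMod k E) (W' : autMod k E') : Prop :=
  exists theta : {morphism [set: E'] >-> E},
    isom [set: E'] [set: E] theta /\
    exists f : {linear W' -> W}, bijective f /\
      forall (a : autg E') (b : autg E),
        (forall e : E', aut_fun b (theta e) = theta (aut_fun a e)) ->
      forall w : W', f (am_act a w) = am_act b (f w).

Record seed (k : fieldType) (I : choiceType) (K : I -> finGroupType) := Seed {
  sd_grp : finGroupType;
  sd_mod : autMod k sd_grp;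
  sd_factor : exists i : I, factor_group sd_grp (K i);
  sd_simple : aut_simple sd_mod }.

(** [W] is isomorphic to the restriction of [M(K i)] along [mu]. *)
Definition iso_Res_mu (k : fieldType) (l : nat -> k) (I : choiceType)
    (K : I -> finGroupType) (i : I) (W : autMod k (K i)) (M : lamMod l K) : Prop :=
  exists f : {linear W -> M}, iso_onto (in_eval i) f /\
    forall (a : autg (K i)) (w : W), f (am_act a w) = lm_act (bas k (Delta_aut a)) (f w).

Section Realization.
Context (k : fieldType) (l : nat -> k) (I : choiceType) (K : I -> finGroupType).

Definition in_Lam_span (J : choiceType) (L : J -> finGroupType)
    (S' : lamMod l (extend K L)) (m : S') : Prop :=
  exists xs : seq (lam k K * S'), m = \sum_(p <- xs) lm_act (lam_incl L p.1) p.2.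

(** [S] is isomorphic to the submodule spanned by [Lambda S'] of [S']. *)
Definition iso_Lam_span (J : choiceType) (L : J -> finGroupType)
    (S : lamMod l K) (S' : lamMod l (extend K L)) : Prop :=
  exists f : {linear S -> S'}, iso_onto (@in_Lam_span J L S') f /\
    forall (x : lam k K) (m : S), f (lm_act x m) = lm_act (lam_incl L x) (f m).

(** [S] is isomorphic to [S_{E,W}]; the existential quantifiers range over the
    choices made in constructing [S_{E,W}]. *)
Definition iso_S (S : lamMod l K) (E : finGroupType) (W : autMod k E) : Prop :=
  exists (J : choiceType) (L : J -> finGroupType),
    subquotient_closed (extend K L) /\
  exists (x : I + J) (W1 : autMod k (extend K L x)),
    aut_simple W1 /\ seed_equiv W W1 /\
  exists S' : lamMod l (extend K L),
    [/\ lam_simple S', minimal_at S' x, iso_Res_mu W1 S' & iso_Lam_span S S'].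

End Realization.

Definition pos_monoid_hom (k : fieldType) (l : nat -> k) : Prop :=
  [/\ l 1%N = 1,
      forall m n : nat, (0 < m)%N -> (0 < n)%N -> l (m * n)%N = l m * l n
    & forall n : nat, (0 < n)%N -> l n != 0].

Definition class_bijection (X Y : Type) (eqX : X -> X -> Prop)
    (eqY : Y -> Y -> Prop) (R : X -> Y -> Prop) : Prop :=
  [/\ forall x x' y y', eqX x x' -> eqY y y' -> R x y -> R x' y',
      forall x, exists y, R x y,
      forall y, exists x, R x y
    & forall x x' y y', R x y -> R x' y' -> (eqX x x' <-> eqY y y')].

(* Main.v *)
Require Import Defs.
From HB Require Import structures.
From mathcomp Require Import all_boot all_order all_algebra all_fingroup all_solvable.
From mathcomp Require Import finmap monalg.
From mathcomp Require Import boolp functions.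

Set Implicit Arguments.
Unset Strict Implicit.
Unset Printing Implicit Defensive.

Import GRing.Theory.

(** Let [Lambda'] be the algebra of a larger family. A finite group [E] is a
    section of [F] exactly when there is a subgroup [A] of [F * E] such that
    [star (conv A) A] is the diagonal of [E], where [conv A] is [A] with the two
    factors exchanged ([factor_group_embeds]). Up to a nonzero scalar, the basis
    elements of [A] and [conv A] then make [E] a direct summand of [F] in the
    category that underlies the algebra. By Goursat's lemma every subgroup of [E * E] that is not the graph of an
    automorphism factors through a proper section of [E], so that a simple module
    takes as value, at a group at which it is minimal, a module for the
    automorphism group alone.

    The modules of different families are compared through a single notion. An
    [extension] of a [Lambda]-module [S] by a module [W] of the automorphism group
    of [E] consists of maps [up] from [W] to [S] and [down] from [S] to [W] that
    behave like the action of the subgroups of [K i * E] and [E * K i]; it does not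
    require [E] to be a member of the family. When [S] and [W] are simple, the
    images of the maps [up] span [S] and the maps [down] separate its points
    ([simple_generated], [simple_separated]). The pairings [down V (up U w)] are
    prescribed by [W], so [S] is determined by [W]: this is
    [pairing_embedding], which gives [extension_iso] and, for modules over two
    families, [extension_iso_Lam_span]. Conversely [S] determines [W] up to
    equivalence ([extension_seed_equiv]), because each of two such groups is a
    section of the other.

    It remains to produce extensions. If [S] is isomorphic to [S_{E,W}], then the
    action of [Lambda'] on [S'] restricts to one ([realization_extension]). A
    simple module [S] acquires one by taking a group [E] of least order through
    which an element not annihilating [S] factors, and for [W] the image in [S] of
    the idempotent attached to [E] ([simple_has_seed]). Every seed has one on a
    concrete simple module, spanned by the functions [V |-> down V (up U w)]
    ([model_mod]); over a family that contains all finite groups up to isomorphism,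
    the same model serves as [S'] ([simple_iso_S]). *)

(** * The star product of subgroups *)

Section StarProduct.
Local Open Scope group_scope.

Lemma starP (F G H : finGroupType) (U : {group F * G}) (V : {group G * H}) f h :
  reflect (exists g, (f, g) \in U /\ (g, h) \in V) ((f, h) \in star U V).
Proof.
rewrite inE; apply: (iffP existsP) => -[g].
  by case/andP; exists g.
by case=> Ug Vg; exists g; apply/andP.
Qed.

Lemma group_pairP (F G : finGroupType) (U V : {group F * G}) :
  (forall f g, ((f, g) \in U) = ((f, g) \in V)) -> U = V.
Proof. by move=> eqUV; apply/val_inj/setP => -[f g]; apply: eqUV. Qed.

Lemma in_Delta (G : finGroupType) (g h : G) : ((g, h) \in Delta G) = (g == h).
Proof.
apply/imsetP/eqP => [[x _ [-> ->]] // | ->].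
by exists h.
Qed.

Lemma in_Delta_aut (E : finGroupType) (a : autg E) (e d : E) :
  ((e, d) \in Delta_aut a) = (e == aut_fun a d).
Proof.
apply/imsetP/eqP => [[x _ [-> ->]] // | ->].
by exists d.
Qed.

Lemma in_slice_r (F G : finGroupType) (U : {group F * G}) g :
  (g \in slice_r U) = ((1, g) \in U).
Proof. by rewrite inE. Qed.

Lemma in_slice_l (F G : finGroupType) (U : {group F * G}) f :
  (f \in slice_l U) = ((f, 1) \in U).
Proof. by rewrite inE. Qed.

Lemma starA (F G H J : finGroupType) (U : {group F * G}) (V : {group G * H})
    (X : {group H * J}) :
  star U (star V X) = star (star U V) X.
Proof.
apply: group_pairP => f j; apply/starP/starP.
  case=> g [Ug /starP[h [Vh Xh]]]; exists h; split=> //.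
  by apply/starP; exists g.
case=> h [/starP[g [Ug Vg]] Xh]; exists g; split=> //.
by apply/starP; exists h.
Qed.

Lemma star_Deltal (F G : finGroupType) (U : {group F * G}) : star (Delta F) U = U.
Proof.
apply: group_pairP => f g; apply/starP/idP.
  by case=> h; rewrite in_Delta => -[/eqP ->].
by move=> Ug; exists f; rewrite in_Delta.
Qed.

Lemma star_Deltar (F G : finGroupType) (U : {group F * G}) : star U (Delta G) = U.
Proof.
apply: group_pairP => f g; apply/starP/idP.
  by case=> h; rewrite in_Delta => -[? /eqP <-].
by move=> Ug; exists g; rewrite in_Delta.
Qed.

Definition conv_set (F G : finGroupType) (U : {group F * G}) : {set G * F} :=
  [set x | (x.2, x.1) \in U].

Lemma conv_group_set (F G : finGroupType) (U : {group F * G}) :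
  group_set (conv_set U).
Proof.
apply/group_setP; split=> [|x y]; first by rewrite inE group1.
by rewrite !inE => Ux Uy; rewrite (groupM Ux Uy).
Qed.

Definition conv (F G : finGroupType) (U : {group F * G}) : {group G * F} :=
  Group (conv_group_set U).

Lemma in_conv (F G : finGroupType) (U : {group F * G}) g f :
  ((g, f) \in conv U) = ((f, g) \in U).
Proof. by rewrite inE. Qed.

Lemma convK (F G : finGroupType) (U : {group F * G}) : conv (conv U) = U.
Proof. by apply: group_pairP => f g; rewrite !in_conv. Qed.

Lemma conv_star (F G H : finGroupType) (U : {group F * G}) (V : {group G * H}) :
  conv (star U V) = star (conv V) (conv U).
Proof.
apply: group_pairP => h f; rewrite in_conv.
by apply/starP/starP => -[g]; rewrite ?in_conv => -[? ?]; exists g; rewrite ?in_conv.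
Qed.

Lemma conv_Delta (G : finGroupType) : conv (Delta G) = Delta G.
Proof. by apply: group_pairP => g h; rewrite in_conv !in_Delta eq_sym. Qed.

Lemma aut_funM (E : finGroupType) (a : autg E) : {morph aut_fun a : x y / x * y}.
Proof.
have /morphicP aM := Aut_morphic (subgP a).
by move=> x y; apply: aM; rewrite inE.
Qed.

Lemma aut_fun1 (E : finGroupType) (a : autg E) : aut_fun a 1 = 1.
Proof. by apply: (mulgI (aut_fun a 1)); rewrite -aut_funM !mulg1. Qed.

Lemma aut_fun_inj (E : finGroupType) (a : autg E) : injective (aut_fun a).
Proof. exact: perm_inj. Qed.

Lemma aut_fun_comp (E : finGroupType) (a b : autg E) e :
  aut_fun (b * a) e = aut_fun a (aut_fun b e).
Proof. by rewrite /aut_fun /= permM. Qed.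

Lemma aut_fun_id (E : finGroupType) e : aut_fun (1 : autg E) e = e.
Proof. by rewrite /aut_fun /= perm1. Qed.

Lemma star_Delta_aut (E : finGroupType) (a b : autg E) :
  star (Delta_aut a) (Delta_aut b) = Delta_aut (b * a).
Proof.
apply: group_pairP => d e; rewrite in_Delta_aut aut_fun_comp.
apply/starP/eqP => [[c []]|->].
  by rewrite !in_Delta_aut => /eqP -> /eqP ->.
by exists (aut_fun b e); rewrite !in_Delta_aut.
Qed.

Lemma Delta_aut1 (E : finGroupType) : Delta_aut (1 : autg E) = Delta E.
Proof. by apply: group_pairP => d e; rewrite in_Delta_aut in_Delta aut_fun_id. Qed.

Lemma Delta_aut_inj (E : finGroupType) : injective (@Delta_aut E).
Proof.
move=> a b eqab; apply/val_inj/permP => e.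
by apply/eqP; rewrite -/(aut_fun a e) -/(aut_fun b e) -in_Delta_aut -eqab in_Delta_aut.
Qed.

End StarProduct.

(** * Subgroups that present one group as a section of another *)

Section Embeddings.
Local Open Scope group_scope.

(** Such an [A] is the graph of an isomorphism from a section of [F] to the
    whole of [E]; the equation makes the calculus of such subgroups algebraic. *)
Definition embeds (F E : finGroupType) (A : {group F * E}) : Prop :=
  star (conv A) A = Delta E.

Lemma embedsP (F E : finGroupType) (A : {group F * E}) :
  embeds A <->
  (forall e, (1, e) \in A -> e = 1) /\ (forall e, exists f, (f, e) \in A).
Proof.
split=> [eA | [A1 Aon]].
  split=> e.
    move=> A1e; apply/eqP; rewrite -in_Delta -eA.
    by apply/starP; exists 1; rewrite in_conv group1.
  have: (e, e) \in star (conv A) A by rewrite eA in_Delta.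
  by case/starP=> f [_ Afe]; exists f.
apply: group_pairP => d e; rewrite in_Delta; apply/starP/eqP => [[f]|->].
  rewrite in_conv => -[Ad Ae].
  have: (f, d) * (f, e)^-1 \in A by rewrite groupM ?groupV.
  rewrite -[(f, e)^-1]/(f^-1, e^-1) -[_ * _]/(f * f^-1, d * e^-1) mulgV.
  by move/A1/(canRL (mulgKV _)); rewrite mul1g.
by have [f Af] := Aon e; exists f; rewrite in_conv.
Qed.

Lemma embeds_Delta (E : finGroupType) : embeds (Delta E).
Proof. by rewrite /embeds conv_Delta star_Deltal. Qed.

Lemma embeds_star (F G E : finGroupType) (A : {group F * G}) (B : {group G * E}) :
  embeds A -> embeds B -> embeds (star A B).
Proof.
move=> eA eB; rewrite /embeds conv_star starA -(starA (conv B)) eA.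
by rewrite star_Deltar eB.
Qed.

Lemma embeds_Delta_aut (E : finGroupType) (a : autg E) : embeds (Delta_aut a).
Proof.
apply/embedsP; split=> e.
  by rewrite in_Delta_aut => /eqP e1; apply: (@aut_fun_inj E a); rewrite aut_fun1.
by exists (aut_fun a e); rewrite in_Delta_aut.
Qed.

Lemma embeds_starr (F G E : finGroupType) (A : {group F * G}) (B : {group G * E}) :
  embeds (star A B) -> embeds B.
Proof.
move=> /embedsP[AB1 ABon]; apply/embedsP; split=> e.
  by move=> B1; apply: AB1; apply/starP; exists 1; rewrite group1.
by have [f /starP[g [_ Bg]]] := ABon e; exists g.
Qed.

Lemma embeds_slice_r (F E : finGroupType) (A : {group F * E}) :
  embeds A -> slice_r A = 1.
Proof.
case/embedsP=> A1 _; apply/setP=> e; rewrite in_slice_r inE.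
by apply/idP/eqP => [/A1 | ->]; rewrite ?group1.
Qed.

Definition proj1_set (F G : finGroupType) (U : {group F * G}) : {set F} :=
  [set f | [exists g, (f, g) \in U]].

Lemma proj1_group_set (F G : finGroupType) (U : {group F * G}) :
  group_set (proj1_set U).
Proof.
apply/group_setP; split=> [|f f']; first by rewrite inE; apply/existsP; exists 1; rewrite group1.
rewrite !inE => /existsP[g Ug] /existsP[g' Ug']; apply/existsP; exists (g * g').
exact: (groupM Ug Ug').
Qed.

Definition proj1 (F G : finGroupType) (U : {group F * G}) : {group F} :=
  Group (proj1_group_set U).

Lemma proj1P (F G : finGroupType) (U : {group F * G}) f :
  reflect (exists g, (f, g) \in U) (f \in proj1 U).
Proof. by rewrite inE; apply: existsP. Qed.

Lemma slice_l_group_set (F G : finGroupType) (U : {group F * G}) :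
  group_set (slice_l U).
Proof.
apply/group_setP; split=> [|f f']; rewrite !in_slice_l ?group1 // => Uf Uf'.
by rewrite -[1]mulg1; apply: (groupM Uf Uf').
Qed.

Definition slice_lg (F G : finGroupType) (U : {group F * G}) : {group F} :=
  Group (slice_l_group_set U).

Lemma slice_l_normal (F G : finGroupType) (U : {group F * G}) :
  slice_lg U <| proj1 U.
Proof.
apply/andP; split.
  by apply/subsetP => f; rewrite in_slice_l => Uf; apply/proj1P; exists 1.
apply/subsetP => f /proj1P[g Ufg]; rewrite inE; apply/subsetP => y /imsetP[x].
rewrite in_slice_l => Ux ->; rewrite in_slice_l.
have: (x, 1) ^ (f, g) \in U by rewrite groupJ.
by rewrite -[_ ^ _]/(x ^ f, 1 ^ g) conj1g.
Qed.

Lemma card_group_pair (F G : finGroupType) (U : {group F * G}) :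
  #|U| = (#|proj1 U| * #|slice_r U|)%N.
Proof.
have fstM : {in U &, {morph (@fst F G) : x y / x * y}} by [].
pose f := Morphism fstM.
have fU : f @* U = proj1 U.
  apply/setP=> x; apply/morphimP/proj1P => [[[y g] _ Uy ->]|[g Ug]]; first by exists g.
  by exists (x, g).
have kf : 'ker f = [set (1, g) | g in slice_r U].
  apply/setP=> -[x g]; apply/idP/imsetP.
    case/morphpreP=> Uxg; rewrite inE => /eqP /= x1.
    by exists g; [rewrite in_slice_r -x1 | rewrite x1].
  case=> h; rewrite in_slice_r => Uh [-> ->].
  by apply/morphpreP; split=> //; rewrite inE.
have <- : #|'ker f| = #|slice_r U| by rewrite kf card_imset // => x y [].
by rewrite -fU card_morphim setIid mulnC Lagrange // subsetIl.
Qed.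

Lemma card_conv (F G : finGroupType) (U : {group F * G}) : #|conv U| = #|U|.
Proof.
have -> : conv U = (fun x => (x.2, x.1)) @: U :> {set _}.
  apply/setP=> -[g f]; rewrite in_conv; apply/idP/imsetP => [Ufg | [[x y] Uxy [-> ->]] //].
  by exists (f, g).
by apply: card_imset => -[x y] [x' y'] [-> ->].
Qed.

Lemma card_embeds (F E : finGroupType) (A : {group F * E}) :
  embeds A -> #|A| = (#|slice_l A| * #|E|)%N.
Proof.
case/embedsP=> _ Aon; rewrite -card_conv card_group_pair mulnC; congr (_ * _)%N.
  by apply: eq_card => f; rewrite in_slice_r in_conv in_slice_l.
rewrite -cardsT; apply: eq_card => e; rewrite [RHS]inE; apply/proj1P.
by have [f Af] := Aon e; exists f; rewrite in_conv.
Qed.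

Lemma card_embeds_proj1 (F E : finGroupType) (A : {group F * E}) :
  embeds A -> #|A| = #|proj1 A|.
Proof. by move=> eA; rewrite card_group_pair embeds_slice_r // cards1 muln1. Qed.

Lemma embeds_leq (F E : finGroupType) (A : {group F * E}) :
  embeds A -> (#|E| <= #|F|)%N.
Proof.
move=> eA; apply: (@leq_trans #|A|).
  by rewrite (card_embeds eA) leq_pmull // -/(#|slice_lg A|) cardG_gt0.
by rewrite (card_embeds_proj1 eA) max_card.
Qed.

(** By counting, an embedding between groups of equal order is the graph of an
    isomorphism. *)
Lemma embeds_conv (F E : finGroupType) (A : {group F * E}) :
  embeds A -> (#|F| <= #|E|)%N -> embeds (conv A).
Proof.
move=> eA leFE; have cA := card_embeds eA; have cA' := card_embeds_proj1 eA.
have s_gt0 : (0 < #|slice_lg A|)%N by apply: cardG_gt0.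
have p_le : (#|proj1 A| <= #|F|)%N by apply: max_card.
have E_gt0 : (0 < #|E|)%N by apply/card_gt0P; exists 1.
have leA : (#|slice_lg A| * #|E| <= 1 * #|E|)%N.
  by rewrite -cA cA' mul1n (leq_trans p_le).
have s1 : #|slice_lg A| = 1%N.
  by apply/eqP; rewrite eqn_leq s_gt0 -(leq_pmul2r E_gt0) leA.
apply/embedsP; split=> f.
  rewrite in_conv -in_slice_l -[slice_l A]/(slice_lg A : {set F}).
  by rewrite (card1_trivg s1) => /set1P.
have pT : proj1 A = [set: F] :> {set F}.
  apply/eqP; rewrite eqEcard subsetT cardsT -cA' cA -/(#|slice_lg A|) s1 mul1n.
  exact: leFE.
have: f \in proj1 A by rewrite pT inE.
by case/proj1P=> e Afe; exists e; rewrite in_conv.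
Qed.

(** [A] is the graph of the map from [M] to [E] induced by the isomorphism; then
    [star A (conv A)] is congruence modulo [N] on [M]. *)
Lemma isog_embeds (F E : finGroupType) (M N : {group F}) :
  N <| M -> [set: E] \isog M / N ->
  exists A : {group F * E}, embeds A /\
    forall f f', (f, f') \in star A (conv A) <->
      [/\ f \in M, f' \in M & f * f'^-1 \in N].
Proof.
move=> nNM /isogP[h injh hE].
have nM := subsetP (normal_norm nNM).
have cosetM : {in M &, {morph coset N : x y / x * y}}.
  by move=> x y Mx My; apply: morphM; apply: nM.
pose S := [set x : F * E | (x.1 \in M) && (coset N x.1 == h x.2)].
have gS : group_set S.
  apply/group_setP; split=> [|[x e] [y d]].
    by rewrite inE /= !morph1 group1 eqxx.
  rewrite !inE /= => /andP[Mx /eqP xe] /andP[My /eqP yd].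
  by rewrite groupM //= cosetM // xe yd morphM ?inE.
exists (Group gS).
have inS f e : ((f, e) \in Group gS) = (f \in M) && (coset N f == h e).
  by rewrite inE.
have h_inj : injective h by move=> x y; apply: (injmP injh); rewrite inE.
split.
  apply/embedsP; split=> e.
    by rewrite inS morph1 => /andP[_ /eqP e1]; apply: h_inj; rewrite -e1 morph1.
  have: h e \in M / N by rewrite -hE mem_morphim ?inE.
  by case/morphimP=> f _ Mf hf; exists f; rewrite inS Mf hf eqxx.
move=> f f'; split.
  case/starP=> e [].
  rewrite in_conv !inS => /andP[Mf /eqP fe] /andP[Mf' /eqP fe']; split=> //.
  apply: coset_idr; first by rewrite groupM ?groupV ?nM.
  by rewrite cosetM ?groupV // morphV ?nM // -[coset_morphism N f']/(coset N f') fe fe' mulgV.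
case=> Mf Mf' Nff.
have: coset N f \in M / N by apply: mem_morphim => //; apply: nM.
rewrite -hE => /morphimP[e _ _ hfe]; apply/starP; exists e.
rewrite in_conv !inS Mf Mf' hfe eqxx /= -hfe; split=> //.
by rewrite -{1}[f](mulgKV f') cosetM ?(groupM, groupV) // (coset_id Nff) mul1g.
Qed.

Lemma embeds_morphism (F E : finGroupType) (A : {group F * E}) :
  embeds A ->
  exists phi : {morphism proj1 A >-> E}, forall f e, (f, e) \in A -> phi f = e.
Proof.
move=> eA.
pose phi f := odflt 1 [pick e | (f, e) \in A].
have phiP f e : (f, e) \in A -> phi f = e.
  move=> Afe; rewrite /phi; case: pickP => [d Afd | /(_ e)]; last by rewrite Afe.
  by apply/eqP; rewrite -in_Delta -eA; apply/starP; exists f; rewrite in_conv.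
have phiM : {in proj1 A &, {morph phi : x y / x * y}}.
  move=> x y /proj1P[d Ad] /proj1P[e Ae]; rewrite (phiP _ _ Ad) (phiP _ _ Ae).
  by apply: phiP; apply: (groupM Ad Ae).
by exists (Morphism phiM).
Qed.

Lemma factor_group_embeds (E F : finGroupType) :
  factor_group E F <-> exists A : {group F * E}, embeds A.
Proof.
split=> [[M [N [nNM iso]]] | [A eA]].
  by have [A [eA _]] := isog_embeds nNM iso; exists A.
exists (proj1 A), (slice_lg A); split; first exact: slice_l_normal.
have [A1 Aon] := iffLR (embedsP A) eA; have [phi phiP] := embeds_morphism eA.
have -> : [set: E] = phi @* proj1 A.
  apply/esym/setP=> e; rewrite inE; apply/morphimP.
  have [f Afe] := Aon e; exists f => //=; last by rewrite (phiP _ _ Afe).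
    by apply/proj1P; exists e.
  by apply/proj1P; exists e.
have -> : slice_lg A = ('ker phi)%G.
  apply/val_inj/setP=> f /=; rewrite in_slice_l.
  apply/idP/morphpreP => [Af1 | [/proj1P[e Afe]]].
    by split; [apply/proj1P; exists 1 | rewrite inE /= (phiP _ _ Af1)].
  by rewrite inE /= (phiP _ _ Afe) => /eqP <-.
rewrite isog_sym; exact: first_isog.
Qed.

Lemma embeds_graph (F E : finGroupType) (A : {group F * E}) :
  embeds A -> (#|F| <= #|E|)%N ->
  exists theta : {morphism [set: E] >-> F}, isom [set: E] [set: F] theta /\
    forall f e, ((f, e) \in A) = (f == theta e).
Proof.
move=> eA leFE; have eA' := embeds_conv eA leFE.
have [A1 Aon] := iffLR (embedsP _) eA.
have [A1' Aon'] := iffLR (embedsP _) eA'.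
have [phi phiP] := embeds_morphism eA'.
have phiM : {in [set: E] &, {morph phi : x y / x * y}}.
  move=> x y _ _; have [f Af] := Aon x; have [d Ad] := Aon y.
  by rewrite morphM //; apply/proj1P; [exists f | exists d]; rewrite in_conv.
have inA f e : ((f, e) \in A) = (f == Morphism phiM e).
  apply/idP/eqP => [Afe | -> /=]; first by rewrite /= (phiP e f) ?in_conv.
  by have [d Ad] := Aon e; rewrite (phiP e d) ?in_conv.
exists (Morphism phiM); split=> //; apply/isomP; split.
  apply/injmP=> x y _ _ eqxy; apply: (mulIg y^-1); rewrite mulgV.
  by apply: A1; rewrite inA morphM ?inE // morphV ?inE // eqxy mulgV.
apply/setP=> f; rewrite inE; apply/morphimP.
by have [e] := Aon' f; rewrite in_conv inA => /eqP ->; exists e.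
Qed.

Lemma embeds_autP (E : finGroupType) (X : {group E * E}) :
  embeds X -> exists a : autg E, X = Delta_aut a.
Proof.
move=> eX; have [theta [/isomP[inj_t im_t] inX]] := embeds_graph eX (leqnn _).
have t_inj : injective theta by move=> x y; apply: (injmP inj_t); rewrite inE.
have aE : perm t_inj \in Aut [set: E].
  rewrite inE; apply/andP; split; first by apply/subsetP => x _; rewrite inE.
  by apply/morphicP => x y _ _; rewrite !permE morphM ?inE.
exists (Subg aE : autg E); apply: group_pairP => f e.
by rewrite inX in_Delta_aut /aut_fun /= permE.
Qed.

(** As [E] is finite, a one-sided inverse is an inverse. *)
Lemma embeds_starl (E : finGroupType) (X Y : {group E * E}) :
  embeds (star X Y) -> embeds X.
Proof.
move=> eXY; have eXY' := embeds_conv eXY (leqnn _).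
rewrite -[X]convK; apply: embeds_conv => //.
by apply: (@embeds_starr _ _ _ (conv Y)); rewrite -conv_star.
Qed.

(** Goursat's lemma: [X] matches the section [proj1 X / slice_l X] of [F] with a
    section of [G]. The group [Q] is left free so that it can be taken in a
    prescribed family of groups. *)
Lemma goursat (F G : finGroupType) (X : {group F * G}) :
  exists M N : {group F}, N <| M /\ forall Q : finGroupType, [set: Q] \isog M / N ->
  exists A : {group F * Q},
    [/\ embeds A, star A (star (conv A) X) = X & embeds (conv (star (conv A) X))].
Proof.
exists (proj1 X), (slice_lg X); split; first exact: slice_l_normal.
move=> Q iso; have [A [eA AA]] := isog_embeds (slice_l_normal X) iso.
have AX : star A (star (conv A) X) = X.
  rewrite starA; apply: group_pairP => f g; apply/starP/idP.
    case=> f' [/AA[_ _]]; rewrite in_slice_l => Xff Xf'.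
    have: (f * f'^-1, 1) * (f', g) \in X by rewrite groupM.
    by rewrite -[_ * _]/((f * f'^-1) * f', 1 * g) mulgKV mul1g.
  move=> Xf; exists f; split=> //; apply/AA; split; last by rewrite mulgV group1.
    by apply/proj1P; exists g.
  by apply/proj1P; exists g.
exists A; split=> //; have [A1 Aon] := iffLR (embedsP A) eA.
apply/embedsP; split=> q.
  rewrite in_conv => /starP[f []]; rewrite in_conv => Afq Xf1.
  suff: (f, 1) \in A.
    move=> Af1; have: (f, q) * (f, 1)^-1 \in A by rewrite groupM ?groupV.
    rewrite -[_ * _]/(f * f^-1, q * 1^-1) mulgV invg1 mulg1; exact: A1.
  have: (f, 1) \in star A (conv A).
    apply/AA; rewrite invg1 mulg1 group1 in_slice_l; split=> //.
    by apply/proj1P; exists 1.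
  case/starP=> q' []; rewrite in_conv => Af' A1'.
  by rewrite -(A1 _ A1').
have [f Afq] := Aon q.
have: (f, f) \in star A (conv A) by apply/starP; exists q; rewrite in_conv.
case/AA=> /proj1P[g Xfg] _ _; exists g; rewrite in_conv; apply/starP; exists f.
by rewrite in_conv.
Qed.

End Embeddings.

(** * The cocycle *)

Section Cocycle.
Context (k : fieldType) (l : nat -> k) (hl : pos_monoid_hom l).
Local Open Scope ring_scope.

Lemma slice_r_group_set (F G : finGroupType) (U : {group F * G}) :
  group_set (slice_r U).
Proof.
apply/group_setP; split=> [|g g']; rewrite !in_slice_r ?group1 // => Ug Ug'.
by rewrite -[1%g]mulg1; apply: (groupM Ug Ug').
Qed.

Definition slice_rg (F G : finGroupType) (U : {group F * G}) : {group G} :=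
  Group (slice_r_group_set U).

Lemma card_slices_gt0 (F G H : finGroupType) (U : {group F * G}) (V : {group G * H}) :
  (0 < #|slice_r U :&: slice_l V|)%N.
Proof. exact: (cardG_gt0 (slice_rg U :&: slice_lg V)%G). Qed.

Lemma sigma_neq0 (F G H : finGroupType) (U : {group F * G}) (V : {group G * H}) :
  sigma l U V != 0.
Proof. by case: hl => _ _; apply; apply: card_slices_gt0. Qed.

(** Both sides count the pairs [(g, h)] in [V] with [(1, g)] in [U] and [(h, 1)]
    in [X], fibred over [h] on the left and over [g] on the right. *)
Lemma sigmaA (F G H J : finGroupType) (U : {group F * G}) (V : {group G * H})
    (X : {group H * J}) :
  sigma l U V * sigma l (star U V) X = sigma l V X * sigma l U (star V X).
Proof.
have [_ lM _] := hl; rewrite -!lM ?card_slices_gt0 //; congr (l _).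
pose Y := (V :&: setX_group (slice_rg U) (slice_lg X))%G.
have inY g h : ((g, h) \in Y) = [&& (g, h) \in V, (1%g, g) \in U & (h, 1%g) \in X].
  by rewrite inE inE /= in_slice_r in_slice_l.
transitivity #|Y|.
  rewrite -card_conv card_group_pair mulnC.
  congr (_ * _)%N; apply: eq_card => x; rewrite in_setI.
    apply/andP/proj1P.
      rewrite in_slice_r in_slice_l => -[/starP[g [Ug Vg]] Xx].
      by exists g; rewrite in_conv inY Vg Ug.
    case=> g; rewrite in_conv inY => /and3P[Vg Ug Xx].
    by rewrite in_slice_r in_slice_l; split=> //; apply/starP; exists g.
  by rewrite [RHS]in_slice_r in_conv inY in_slice_r in_slice_l group1 andbT andbC.
rewrite card_group_pair mulnC; congr (_ * _)%N; apply: eq_card => x.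
  by rewrite [LHS]in_slice_r inY in_setI in_slice_r in_slice_l group1.
rewrite in_setI; apply/proj1P/andP.
  case=> h; rewrite inY in_slice_r in_slice_l => /and3P[Vxh Ux Xh].
  by split=> //; apply/starP; exists h.
rewrite in_slice_r in_slice_l => -[Ux /starP[h [Vxh Xh]]].
by exists h; rewrite inY Vxh Ux.
Qed.

Lemma sigma_embeds (F E H : finGroupType) (A : {group F * E}) (V : {group E * H}) :
  embeds A -> sigma l A V = 1.
Proof.
move=> eA; have [l1 _ _] := hl; rewrite /sigma embeds_slice_r //.
by rewrite (setIidPl _) ?cards1 // sub1set in_slice_l group1.
Qed.

Lemma sigma_conv (F G H : finGroupType) (U : {group F * G}) (V : {group G * H}) :
  sigma l (conv V) (conv U) = sigma l U V.
Proof.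
congr (l _); rewrite setIC; apply: eq_card => g.
by rewrite !inE.
Qed.

Lemma sigma_embeds_conv (F E H : finGroupType) (A : {group F * E}) (U : {group H * E}) :
  embeds A -> sigma l U (conv A) = 1.
Proof. by move=> eA; rewrite -[U]convK sigma_conv sigma_embeds. Qed.

Lemma sigma_Deltal (F G : finGroupType) (U : {group F * G}) : sigma l (Delta F) U = 1.
Proof. exact/sigma_embeds/embeds_Delta. Qed.

Lemma sigma_Deltar (F G : finGroupType) (U : {group F * G}) : sigma l U (Delta G) = 1.
Proof. by rewrite -(conv_Delta G) sigma_embeds_conv //; apply: embeds_Delta. Qed.

Lemma sigma_starl (F E G H : finGroupType) (A : {group F * E}) (V : {group E * G})
    (X : {group G * H}) :
  embeds A -> sigma l (star A V) X = sigma l V X.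
Proof. by move=> eA; have := sigmaA A V X; rewrite !(sigma_embeds _ eA) mul1r mulr1. Qed.

Lemma sigma_star_conv (F G H E : finGroupType) (A : {group H * E}) (U : {group F * G})
    (V : {group G * E}) :
  embeds A -> sigma l U (star V (conv A)) = sigma l U V.
Proof.
by move=> eA; rewrite -sigma_conv conv_star convK sigma_starl // sigma_conv.
Qed.

Lemma sigma_Delta_aut (F E : finGroupType) (U : {group F * E}) (a : autg E) :
  sigma l U (Delta_aut a) = 1.
Proof.
have ea := embeds_conv (embeds_Delta_aut a) (leqnn _).
by rewrite -[Delta_aut a]convK sigma_embeds_conv.
Qed.

(** Passing from [E] to a group of which it is a section, by means of [A],
    multiplies every product by the same scalar, which can be divided out. *)
Lemma sigma_cancel (F G H E : finGroupType) (A : {group F * E}) (X : {group G * E})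
    (Y : {group E * H}) :
  embeds A ->
  sigma l (star X (conv A)) (star A Y) = sigma l (conv A) A * sigma l X Y.
Proof.
move=> eA; have cA := sigmaA X (conv A) A.
rewrite sigma_embeds_conv // mul1r eA sigma_Deltar mulr1 in cA.
have := sigmaA (star X (conv A)) A Y.
by rewrite (sigma_embeds Y eA) mul1r cA -starA eA star_Deltar.
Qed.

Lemma star_cancel (F G H E : finGroupType) (A : {group F * E}) (X : {group G * E})
    (Y : {group E * H}) :
  embeds A -> star (star X (conv A)) (star A Y) = star X Y.
Proof. by move=> eA; rewrite starA -(starA X) eA star_Deltar. Qed.

End Cocycle.

(** * Linear algebra *)

Section LinearExtension.
Local Open Scope ring_scope.
Context (k : fieldType) (T : choiceType) (V : lmodType k) (f : T -> V).

Definition lext (x : {malg k[T]}) : V := \sum_(s <- msupp x) x@_s *: f s.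

Lemma lextEw (d : {fset T}) (x : {malg k[T]}) :
  (msupp x `<=` d)%fset -> lext x = \sum_(s <- d) x@_s *: f s.
Proof.
move=> le_d; apply: big_fset_incl => // s _ /mcoeff_outdom ->.
by rewrite scale0r.
Qed.

Lemma lext_linear : linear lext.
Proof.
move=> a x y; pose d := (msupp x `|` msupp y `|` msupp (a *: x + y))%fset.
rewrite !(@lextEw d) ?/d ?fsubsetUr //; last first.
- by apply/fsubsetP => s; rewrite !inE => ->.
- by apply/fsubsetP => s; rewrite !inE => ->; rewrite orbT.
rewrite scaler_sumr -big_split; apply: eq_bigr => s _ /=.
by rewrite mcoeffD mcoeffZ scalerDl scalerA.
Qed.

HB.instance Definition _ :=
  GRing.isLinear.Build k {malg k[T]} V *:%R lext lext_linear.

Lemma lextU (s : T) : lext << s >> = f s.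
Proof.
rewrite (lextEw (msuppU_le)) big_seq_fset1 mcoeffUU scale1r //.
Qed.

End LinearExtension.

Section Submodules.
Local Open Scope ring_scope.
Context (k : fieldType) (V : lmodType k).

(** The subspaces that occur are defined by undecidable conditions, which are
    made boolean so as to obtain the module structure of the subtype. *)
Record submodule := Submodule {
  in_submodule :> V -> Prop;
  submodule0 : in_submodule 0;
  submodule_lin : forall (a : k) u v,
    in_submodule u -> in_submodule v -> in_submodule (a *: u + v) }.

Variable P : submodule.

Definition submodule_pred : {pred V} := fun v => `[< P v >].

Fact submodule_closed : submod_closed submodule_pred.
Proof.
split; first by apply/asboolP/submodule0.
by move=> a u v /asboolP Pu /asboolP Pv; apply/asboolP/submodule_lin.
Qed.
HB.instance Definition _ :=
  GRing.isSubmodClosed.Build k V submodule_pred submodule_closed.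

Record submodule_type := SubmoduleElt {
  sub_val : V;
  sub_valP : sub_val \in submodule_pred }.
HB.instance Definition _ := [isSub for sub_val].
HB.instance Definition _ := [Choice of submodule_type by <:].
HB.instance Definition _ := [SubChoice_isSubLmodule of submodule_type by <:].

Lemma submodule_elt (v : V) : P v -> {u : submodule_type | sub_val u = v}.
Proof. by move=> /asboolP Pv; exists (SubmoduleElt Pv). Qed.

Lemma sub_val_in (u : submodule_type) : P (sub_val u).
Proof. by apply/asboolP/sub_valP. Qed.

Lemma sub_val_linear : linear sub_val.
Proof. exact: (linearP (val : {linear submodule_type -> V})). Qed.
HB.instance Definition _ :=
  GRing.isLinear.Build k submodule_type V *:%R sub_val sub_val_linear.

Lemma sub_val_inj : injective sub_val.
Proof. exact: val_inj. Qed.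

End Submodules.


Section Spans.
Local Open Scope ring_scope.
Context (k : fieldType) (W : lmodType k).

Definition spanned (V : lmodType k) (A : Type) (p : A -> {linear W -> V}) (v : V) : Prop :=
  exists xs : seq (A * W), v = \sum_(x <- xs) p x.1 x.2.

Lemma spanned1 (V : lmodType k) (A : Type) (p : A -> {linear W -> V}) a w :
  spanned p (p a w).
Proof. by exists [:: (a, w)]; rewrite big_seq1. Qed.

Lemma spanned0 (V : lmodType k) (A : Type) (p : A -> {linear W -> V}) : spanned p 0.
Proof. by exists [::]; rewrite big_nil. Qed.

Lemma spanned_lin (V : lmodType k) (A : Type) (p : A -> {linear W -> V}) (c : k) u v :
  spanned p u -> spanned p v -> spanned p (c *: u + v).
Proof.
case=> [xs ->] [ys ->]; exists ([seq (x.1, c *: x.2) | x <- xs] ++ ys).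
rewrite big_cat big_map scaler_sumr; congr (_ + _).
by apply: eq_bigr => x _; rewrite linearZ.
Qed.

Definition span_sub (V : lmodType k) (A : Type) (p : A -> {linear W -> V}) : submodule V :=
  Submodule (spanned0 p) (@spanned_lin V A p).

Lemma submodule_sum (V : lmodType k) (P : submodule V) (X : Type) (xs : seq X)
    (F : X -> V) :
  (forall x, P (F x)) -> P (\sum_(x <- xs) F x).
Proof.
move=> PF; elim: xs => [|x xs IH]; first by rewrite big_nil; apply: submodule0.
by rewrite big_cons -[F x]scale1r; apply: submodule_lin.
Qed.

Lemma submoduleZ (V : lmodType k) (P : submodule V) (c : k) v : P v -> P (c *: v).
Proof. by move=> Pv; rewrite -[_ *: _]addr0; apply: submodule_lin => //; apply: submodule0. Qed.

Lemma bijectiveP (X Y : Type) (f : X -> Y) :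
  injective f -> (forall y, exists x, y = f x) -> bijective f.
Proof.
move=> f_inj f_onto; exists (fun y => sval (cid (f_onto y))) => [x|y].
  by case: cid => z /= /f_inj.
by case: cid.
Qed.

Lemma linear_lift (V U T : lmodType k) (f : {linear V -> U}) (h : {linear T -> U}) :
  injective f -> (forall t, exists v, h t = f v) ->
  {g : {linear T -> V} | forall t, f (g t) = h t}.
Proof.
move=> f_inj fh; pose g t := sval (cid (fh t)).
have fg t : f (g t) = h t by rewrite /g; case: cid.
have g_lin : linear g.
  by move=> c t u; apply: f_inj; rewrite linearP !fg linearP.
pose L := GRing.isLinear.Build k T V *:%R g g_lin.
pose G : {linear T -> V} := HB.pack g L.
by exists G.
Qed.

Lemma linear_inverse (V U : lmodType k) (f : {linear V -> U}) :
  bijective f -> {g : {linear U -> V} | cancel f g & cancel g f}.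
Proof.
move=> bij_f; have f_onto u : exists v, idfun u = f v.
  by have [g _ fK] := bij_f; exists (g u); rewrite fK.
have [g fK] := linear_lift (bij_inj bij_f) f_onto.
by exists g => // v; apply: (bij_inj bij_f); rewrite fK.
Qed.

(** Two families of generators that have the same pairings with a separating
    family of functionals satisfy the same linear relations. *)
Lemma pairing_embedding (V1 V2 : lmodType k) (A B : Type)
    (p1 : A -> {linear W -> V1}) (p2 : A -> {linear W -> V2})
    (q1 : B -> {linear V1 -> W}) (q2 : B -> {linear V2 -> W}) :
  (forall v, spanned p1 v) ->
  (forall v, (forall b, q1 b v = 0) -> v = 0) ->
  (forall v, spanned p2 v -> (forall b, q2 b v = 0) -> v = 0) ->
  (forall a b w, q1 b (p1 a w) = q2 b (p2 a w)) ->
  exists f : {linear V1 -> V2}, injective f /\ forall a w, f (p1 a w) = p2 a w.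
Proof.
move=> span1 ker1 ker2 pq.
pose ev2 (xs : seq (A * W)) := \sum_(x <- xs) p2 x.1 x.2.
pose ev1 (xs : seq (A * W)) := \sum_(x <- xs) p1 x.1 x.2.
have qev b xs : q2 b (ev2 xs) = q1 b (ev1 xs).
  by rewrite !linear_sum; apply: eq_bigr => x _; rewrite pq.
pose g v := ev2 (sval (cid (span1 v))).
have gq b v : q2 b (g v) = q1 b v.
  by rewrite /g qev; case: cid => xs /= ->.
have g_span v : spanned p2 (g v) by exists (sval (cid (span1 v))).
have gP u v : spanned p2 v -> (forall b, q2 b v = q1 b u) -> g u = v.
  move=> v_span uv; apply/eqP; rewrite -subr_eq0 -scaleN1r addrC; apply/eqP.
  apply: ker2 => [|b]; first exact: spanned_lin.
  by rewrite linearP gq uv scaleN1r addNr.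
have g_lin : linear g.
  move=> c u v; apply: gP => [|b]; first exact: spanned_lin.
  by rewrite !linearP !gq.
pose L := GRing.isLinear.Build k V1 V2 *:%R g g_lin.
pose G : {linear V1 -> V2} := HB.pack g L.
exists G; split=> [|a w]; last by apply: gP => [|b]; [apply: spanned1 | rewrite pq].
move=> u v /= guv; apply/eqP; rewrite -subr_eq0; apply/eqP/ker1 => b.
by rewrite linearB -!gq guv subrr.
Qed.

End Spans.

(** * Modules over the deformed category algebra *)

Section Action.
Local Open Scope ring_scope.
Context (k : fieldType) (l : nat -> k) (hl : pos_monoid_hom l).
Context (I : choiceType) (K : I -> finGroupType).

Lemma symb_mulE i j h (U : {group K i * K j}) (V : {group K j * K h}) :
  symb_mul l (Symb U) (Symb V) = sigma l U V *: bas k (star U V).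
Proof.
rewrite /symb_mul /=; case: eqP => // e.
by rewrite (eq_axiomK e).
Qed.

Lemma symb_mul_neq (s t : symb K) : symb_r s <> symb_l t -> symb_mul l s t = 0.
Proof. by rewrite /symb_mul; case: eqP. Qed.

Lemma lam_mulE (x y : lam k K) :
  lam_mul l x y = lext (fun s => lext (symb_mul l s) y) x.
Proof.
rewrite /lam_mul /lext; apply: eq_bigr => s _; rewrite scaler_sumr.
by apply: eq_bigr => t _; rewrite scalerA.
Qed.

Lemma lam_mul_bas i j h g (U : {group K i * K j}) (V : {group K h * K g}) :
  lam_mul l (bas k U) (bas k V) = symb_mul l (Symb U) (Symb V).
Proof. by rewrite lam_mulE /bas !lextU. Qed.

HB.instance Definition _ (M : lamMod l K) (x : lam k K) :=
  GRing.isLinear.Build k M M *:%R (lm_act x) (lm_linr x).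

Definition sact (M : lamMod l K) i j (X : {group K i * K j}) : {linear M -> M} :=
  lm_act (bas k X).
Arguments sact : simpl never.

Lemma lm_actE (M : lamMod l K) (x : lam k K) (m : M) :
  lm_act x m = lext (fun s => sact M (symb_grp s) m) x.
Proof.
pose L := GRing.isLinear.Build k (lam k K) M *:%R (@lm_act k l I K M ^~ m) (lm_linl m).
pose f : {linear lam k K -> M} := HB.pack (@lm_act k l I K M ^~ m) L.
rewrite -[LHS]/(f x) [in LHS](monalgE x) linear_sum; apply: eq_bigr => s _.
have -> : << x@_s *g s >> = x@_s *: bas k (symb_grp s) :> lam k K.
  apply/malgP => t; rewrite mcoeffZ !mcoeffU.
  by case: s => i j U /=; case: (_ == _); rewrite ?mulr1 ?mulr0.
by rewrite linearZ.
Qed.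

Lemma sact_sact (M : lamMod l K) i j h (X : {group K i * K j}) (Y : {group K j * K h}) m :
  sact M X (sact M Y m) = sigma l X Y *: sact M (star X Y) m.
Proof.
rewrite /sact /= -lm_actA lam_mul_bas symb_mulE.
by rewrite lm_actE [in RHS]lm_actE linearZ.
Qed.

Lemma sact_neq (M : lamMod l K) i j j' h (X : {group K i * K j}) (Y : {group K j' * K h}) m :
  j <> j' -> sact M X (sact M Y m) = 0.
Proof.
move=> ne; rewrite /sact /= -lm_actA lam_mul_bas symb_mul_neq //.
by rewrite lm_actE linear0.
Qed.

Lemma sact_Delta (M : lamMod l K) i j (X : {group K i * K j}) m :
  sact M (Delta (K i)) (sact M X m) = sact M X m.
Proof. by rewrite sact_sact sigma_Deltal // star_Deltal scale1r. Qed.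

Definition act_stable (M : lamMod l K) (P : submodule M) : Prop :=
  forall i j (X : {group K i * K j}) m, P m -> P (sact M X m).

Lemma lam_simpleP (M : lamMod l K) :
  lam_simple M <->
  (exists m : M, m != 0) /\
  forall P : submodule M, act_stable P -> (exists m, P m /\ m != 0) -> forall m, P m.
Proof.
split=> -[nz sM]; split=> // P.
  move=> Pst [m [Pm m0]].
  case: (sM P (submodule0 P) (@submodule_lin _ _ P)) => [x v Pv | P0 | //].
    by rewrite lm_actE; apply: submodule_sum => s; apply/submoduleZ/Pst.
  by rewrite (P0 m Pm) eqxx in m0.
move=> P0 Plin Pst; have [[m [Pm m0]] | noP] := pselect (exists m, P m /\ m != 0).
  by right; apply: (sM (Submodule P0 Plin)) => [i j X v /Pst|]; [apply | exists m].
left=> v Pv; apply/eqP/negPn/negP => v0; apply: noP.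
by exists v.
Qed.

End Action.

Section AutModules.
Local Open Scope ring_scope.
Context (k : fieldType) (E : finGroupType) (W : autMod k E).

HB.instance Definition _ (a : autg E) :=
  GRing.isLinear.Build k W W *:%R (@am_act k E W a) (am_lin a).

Lemma aut_simpleP :
  aut_simple W <->
  (exists w : W, w != 0) /\
  forall P : submodule W, (forall a w, P w -> P (am_act a w)) ->
    (exists w, P w /\ w != 0) -> forall w, P w.
Proof.
split=> -[nz sW]; split=> // P.
  move=> Pst [m [Pm m0]].
  case: (sW P (submodule0 P) (@submodule_lin _ _ P)) => // P0.
  by rewrite (P0 m Pm) eqxx in m0.
move=> P0 Plin Pst; have [[m [Pm m0]] | noP] := pselect (exists m, P m /\ m != 0).
  by right; apply: (sW (Submodule P0 Plin)) => //; exists m.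
left=> v Pv; apply/eqP/negPn/negP => v0; apply: noP.
by exists v.
Qed.

(** The subgroups of [E * E] act on [W] through the quotient of the endomorphism
    algebra of [E] in which those factoring through smaller groups vanish. *)
Definition grp_act (X : {group E * E}) (w : W) : W :=
  if [pick a | Delta_aut a == X] is Some a then am_act a w else 0.

Lemma grp_act_linear X : linear (grp_act X).
Proof.
move=> c u v; rewrite /grp_act; case: pickP => [a _ | _]; first exact: am_lin.
by rewrite scaler0 addr0.
Qed.
HB.instance Definition _ X :=
  GRing.isLinear.Build k W W *:%R (grp_act X) (grp_act_linear X).

Lemma grp_act_aut a w : grp_act (Delta_aut a) w = am_act a w.
Proof.
rewrite /grp_act; case: pickP => [b /eqP/Delta_aut_inj -> // | /(_ a)].
by rewrite eqxx.
Qed.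

Lemma grp_act_eq0 X w : ~ embeds X -> grp_act X w = 0.
Proof.
move=> neX; rewrite /grp_act; case: pickP => // a /eqP aX.
by case: neX; rewrite -aX; apply: embeds_Delta_aut.
Qed.

Lemma grp_act_neq0 X w : grp_act X w != 0 -> embeds X.
Proof. by apply: contra_neqP => /grp_act_eq0. Qed.

Lemma grp_act_Delta w : grp_act (Delta E) w = w.
Proof. by rewrite -Delta_aut1 grp_act_aut am_act1. Qed.

(** The subgroups that are not graphs of automorphisms span an ideal, and [sigma]
    is trivial on graphs of automorphisms. *)
Lemma grp_actM (l : nat -> k) (hl : pos_monoid_hom l) X Y w :
  grp_act X (grp_act Y w) = sigma l X Y *: grp_act (star X Y) w.
Proof.
have [eXY | neXY] := pselect (embeds (star X Y)).
  have eX := embeds_starl eXY; have eY := embeds_starr eXY.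
  have [a ->] := embeds_autP eX; have [b ->] := embeds_autP eY.
  rewrite star_Delta_aut !grp_act_aut am_actM sigma_embeds ?scale1r //.
  exact: embeds_Delta_aut.
rewrite (grp_act_eq0 _ neXY) scaler0.
have [eX | /grp_act_eq0 -> //] := pselect (embeds X).
have [eY | /grp_act_eq0 ->] := pselect (embeds Y); last by rewrite linear0.
by case: neXY; apply: embeds_star.
Qed.

End AutModules.

(** * Extending a module to one further group *)

Section Extension.
Local Open Scope ring_scope.
Context (k : fieldType) (l : nat -> k) (hl : pos_monoid_hom l).
Context (I : choiceType) (K : I -> finGroupType).

(** An extension of [M] to the category with the further object [E], where [E]
    is given the value [W]: the maps [up] and [down] are the actions of the
    subgroups between [E] and the groups of the family. *)
Record extension (M : lamMod l K) (E : finGroupType) (W : autMod k E) := Extension {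
  up : forall i, {group K i * E} -> {linear W -> M};
  down : forall i, {group E * K i} -> {linear M -> W};
  sact_up : forall i j (X : {group K i * K j}) (U : {group K j * E}) w,
    sact M X (up U w) = sigma l X U *: up (star X U) w;
  down_sact : forall i j (V : {group E * K i}) (X : {group K i * K j}) m,
    down V (sact M X m) = sigma l V X *: down (star V X) m;
  down_up : forall i (V : {group E * K i}) (U : {group K i * E}) w,
    down V (up U w) = sigma l V U *: grp_act (star V U) w }.

Section OneExtension.
Context (M : lamMod l K) (E : finGroupType) (W : autMod k E) (e : extension M W).

Lemma sact_Delta_up i (U : {group K i * E}) w : sact M (Delta (K i)) (up e U w) = up e U w.
Proof. by rewrite sact_up sigma_Deltal // star_Deltal scale1r. Qed.

Lemma down_sact_Delta i (V : {group E * K i}) m : down e V (sact M (Delta (K i)) m) = down e V m.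
Proof. by rewrite down_sact sigma_Deltar // star_Deltar scale1r. Qed.

Lemma sact_up_neq i j j' (X : {group K i * K j}) (U : {group K j' * E}) w :
  j <> j' -> sact M X (up e U w) = 0.
Proof. by move=> ne; rewrite -sact_Delta_up sact_neq. Qed.

Lemma down_sact_neq i i' j (V : {group E * K i}) (X : {group K i' * K j}) m :
  i <> i' -> down e V (sact M X m) = 0.
Proof. by move=> ne; rewrite -down_sact_Delta sact_neq // linear0. Qed.

Lemma down_up_neq i j (V : {group E * K i}) (U : {group K j * E}) w :
  i <> j -> down e V (up e U w) = 0.
Proof. by move=> ne; rewrite -sact_Delta_up down_sact_neq. Qed.

Definition ups (a : {i : I & {group K i * E}}) : {linear W -> M} := up e (tagged a).
Definition downs (b : {i : I & {group E * K i}}) : {linear M -> W} := down e (tagged b).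

(** These two conditions say that [M] is the image of the module induced from
    [W] in the one coinduced from [W]. *)
Definition up_generated : Prop := forall m, spanned ups m.
Definition down_separated : Prop :=
  forall m, (forall i (V : {group E * K i}), down e V m = 0) -> m = 0.

Lemma spanned_up i (U : {group K i * E}) w : spanned ups (up e U w).
Proof. exact: (spanned1 ups (Tagged (fun i => {group K i * E}) U)). Qed.

Lemma span_ups_stable : act_stable (span_sub ups).
Proof.
move=> i j X _ [xs ->]; rewrite linear_sum.
apply: (submodule_sum (P := span_sub ups)) => -[[j' U] w] /=; rewrite /ups /=.
have [ejj' | /eqP ne] := eqVneq j j'; last by rewrite sact_up_neq //; apply: spanned0.
subst j'; rewrite sact_up; apply: (submoduleZ (P := span_sub ups)).
exact: spanned_up.
Qed.

Lemma ker_downs0 i (V : {group E * K i}) : down e V 0 = 0.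
Proof. exact: linear0. Qed.

Lemma ker_downs_lin (c : k) u v :
  (forall i (V : {group E * K i}), down e V u = 0) ->
  (forall i (V : {group E * K i}), down e V v = 0) ->
  forall i (V : {group E * K i}), down e V (c *: u + v) = 0.
Proof. by move=> u0 v0 i V; rewrite linearP u0 v0 scaler0 addr0. Qed.

Definition ker_downs : submodule M := Submodule ker_downs0 ker_downs_lin.

Lemma ker_downs_stable : act_stable ker_downs.
Proof.
move=> i j X m m0 i' V.
have [eii' | /eqP ne] := eqVneq i' i; last by rewrite down_sact_neq.
by subst i'; rewrite down_sact m0 scaler0.
Qed.

Section Embedded.
Context (i0 : I) (A : {group K i0 * E}) (eA : embeds A).

Lemma down_up_embeds w : down e (conv A) (up e A w) = sigma l (conv A) A *: w.
Proof. by rewrite down_up eA grp_act_Delta. Qed.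

Lemma up_embeds_inj : injective (up e A).
Proof.
move=> u v /(congr1 (down e (conv A))); rewrite !down_up_embeds.
exact/scalerI/sigma_neq0.
Qed.

(** The span of the maps [up] and the common kernel of the maps [down] are
    submodules, and [A] shows that the first is nonzero and the second proper. *)
Lemma simple_generated : lam_simple M -> (exists w : W, w != 0) -> up_generated.
Proof.
move=> /lam_simpleP[_ sM] [w w0] m; apply: (sM (span_sub ups) span_ups_stable).
exists (up e A w); split; first exact: spanned_up.
by apply: contra_neq w0 => /eqP; rewrite -(linear0 (up e A)) => /eqP/up_embeds_inj.
Qed.

Lemma simple_separated : lam_simple M -> (exists w : W, w != 0) -> down_separated.
Proof.
move=> /lam_simpleP[_ sM] [w w0] m m_ker; apply/eqP/negPn/negP => m0.
have ker_all : forall v, ker_downs v.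
  by apply: sM; [apply: ker_downs_stable | exists m].
have := ker_all (up e A w) _ (conv A); rewrite down_up_embeds.
by move/eqP; rewrite scaler_eq0 (negPf (sigma_neq0 hl _ _)) (negPf w0).
Qed.

(** A submodule [P] of [W] gives the submodule of those elements of [M] that all
    maps [down] send into [P]; its preimage under [up e A] is [P]. *)
Lemma simple_aut_simple : lam_simple M -> (exists w : W, w != 0) -> aut_simple W.
Proof.
move=> sM W0; apply/aut_simpleP; split=> // P Pst [w [Pw w0]] u.
have Pgrp X v : P v -> P (grp_act X v).
  rewrite /grp_act => Pv; case: pickP => [a _|_]; [exact: Pst | exact: submodule0].
pose P' (m : M) := forall i (V : {group E * K i}), P (down e V m).
have P'lin : forall (c : k) m n, P' m -> P' n -> P' (c *: m + n).
  by move=> c m n Pm Pn i V; rewrite linearP; apply: submodule_lin.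
have P'0 : P' 0 by move=> i V; rewrite linear0; apply: submodule0.
have [_ simp] := iffLR (lam_simpleP M) sM.
have {}simp := simp (Submodule P'0 P'lin).
suff: P' (up e A u).
  move/(_ _ (conv A)); rewrite down_up_embeds.
  move/(submoduleZ (P := P) (sigma l (conv A) A)^-1).
  by rewrite scalerA mulVf ?scale1r ?sigma_neq0.
apply: simp => [i j X m Pm i' V | ].
  have [eii' | /eqP ne] := eqVneq i' i.
    by subst i'; rewrite down_sact; apply/submoduleZ/Pm.
  by rewrite down_sact_neq //; apply: submodule0.
exists (up e A w); split.
  move=> i V; have [eii' | /eqP ne] := eqVneq i i0.
    by subst i; rewrite down_up; apply/submoduleZ/Pgrp.
  by rewrite down_up_neq //; apply: submodule0.
by apply: contra_neq w0 => /eqP; rewrite -(linear0 (up e A)) => /eqP/up_embeds_inj.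
Qed.

End Embedded.

Section Nondegenerate.
Context (gen : up_generated) (sep : down_separated).

Lemma down_separatedP m n : (forall i (V : {group E * K i}), down e V m = down e V n) -> m = n.
Proof.
move=> mn; apply/eqP; rewrite -subr_eq0; apply/eqP/sep => i V.
by rewrite linearB mn subrr.
Qed.

(** The remaining compatibilities of an action of the category with [E] added
    hold because they hold after applying the maps [down]. *)
Lemma up_grp_act i (U : {group K i * E}) X w :
  up e U (grp_act X w) = sigma l U X *: up e (star U X) w.
Proof.
apply: down_separatedP => j V; have [eij | /eqP ne] := eqVneq j i; last first.
  by rewrite linearZ /= !down_up_neq // scaler0.
by subst j; rewrite linearZ /= !down_up (grp_actM hl) !scalerA starA sigmaA.
Qed.

Lemma up_down i j (U : {group K i * E}) (V : {group E * K j}) m :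
  up e U (down e V m) = sigma l U V *: sact M (star U V) m.
Proof.
have [xs ->] := gen m; rewrite !linear_sum /=; apply: eq_bigr => -[[h Y] w] _ /=.
rewrite /ups /=; have [ejh | /eqP ne] := eqVneq j h; last first.
  by rewrite down_up_neq // sact_up_neq // linear0 scaler0.
subst h; rewrite down_up sact_up linearZ /= up_grp_act !scalerA starA; congr (_ *: _).
by rewrite [RHS]sigmaA // mulrC.
Qed.

(** From a nonzero [m] in a submodule [P] one reaches a nonzero element of [W]
    by some map [down]; the set of elements of [W] that all maps [up] send into [P]
    contains it and is stable, so it is [W], and [P] contains all generators. *)
Lemma nondegenerate_simple i0 (A : {group K i0 * E}) :
  embeds A -> aut_simple W -> lam_simple M.
Proof.
move=> eA /aut_simpleP[[w w0] sW]; apply/lam_simpleP => //; split.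
  exists (up e A w).
  by apply: contra_neq w0 => /eqP; rewrite -(linear0 (up e A)) => /eqP/(up_embeds_inj eA).
move=> P Pst [m [Pm m0]].
pose Q (u : W) := forall i (U : {group K i * E}), P (up e U u).
have Q0 : Q 0 by move=> i U; rewrite linear0; apply: submodule0.
have Qlin (c : k) u v : Q u -> Q v -> Q (c *: u + v).
  by move=> Qu Qv i U; rewrite linearP; apply: submodule_lin.
have Q_all : forall u, Q u.
  apply: (sW (Submodule Q0 Qlin)) => [a u Qu i U | ].
    by rewrite -grp_act_aut up_grp_act; apply/submoduleZ/Qu.
  have [j [V Vm]] : exists j (V : {group E * K j}), down e V m != 0.
    apply: contrapT => nV; case/eqP: m0; apply: sep => j V; apply/eqP/negPn/negP => Vm.
    by apply: nV; exists j, V.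
  exists (down e V m); split=> // i U; rewrite up_down.
  exact/submoduleZ/Pst.
by move=> n; have [xs ->] := gen n; apply: submodule_sum => x; apply: Q_all.
Qed.

End Nondegenerate.

End OneExtension.

End Extension.

(** * Equivalence of seeds *)

Section SeedEquivalence.
Local Open Scope group_scope.
Context (k : fieldType).

Lemma embeds_isom (E E' : finGroupType) (theta : {morphism [set: E'] >-> E}) :
  isom [set: E'] [set: E] theta ->
  exists Y : {group E * E'}, [/\ embeds Y, embeds (conv Y) &
    forall e e', ((e, e') \in Y) = (e == theta e')].
Proof.
case/isomP=> inj_t im_t.
have gY : group_set [set x : E * E' | x.1 == theta x.2].
  apply/group_setP; split=> [|[x x'] [y y']]; first by rewrite inE /= morph1.
  by rewrite !inE /= => /eqP -> /eqP ->; rewrite morphM ?inE.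
have inY e e' : ((e, e') \in Group gY) = (e == theta e') by rewrite inE.
exists (Group gY); split=> //; apply/embedsP; split=> x.
- rewrite inY => /eqP x1; apply: (injmP inj_t); rewrite ?inE //.
  by rewrite -x1 morph1.
- by exists (theta x); rewrite inY.
- by rewrite in_conv inY morph1 => /eqP.
have: x \in theta @* [set: E'] by rewrite im_t inE.
by case/morphimP=> y _ _ ->; exists y; rewrite in_conv inY.
Qed.

Lemma star_graph_aut (E E' : finGroupType) (Y : {group E * E'})
    (theta : E' -> E) (a : autg E') (b : autg E) :
  (forall e e', ((e, e') \in Y) = (e == theta e')) ->
  star (Delta_aut b) Y = star Y (Delta_aut a) <->
  forall e', aut_fun b (theta e') = theta (aut_fun a e').
Proof.
move=> inY; split=> [eqY e' | eqt].
  have: (aut_fun b (theta e'), e') \in star (Delta_aut b) Y.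
    by apply/starP; exists (theta e'); rewrite in_Delta_aut inY !eqxx.
  by rewrite eqY => /starP[d []]; rewrite in_Delta_aut inY => /eqP -> /eqP ->.
apply: group_pairP => e e'; apply/starP/starP => -[d []].
  rewrite in_Delta_aut inY => /eqP -> /eqP ->; exists (aut_fun a e').
  by rewrite inY in_Delta_aut eqt !eqxx.
rewrite in_Delta_aut inY => /eqP -> /eqP ->; exists (theta e').
by rewrite inY in_Delta_aut eqt !eqxx.
Qed.

(** In terms of graphs, equivalences of seeds can be inverted and composed by
    means of [conv] and [star]. *)
Lemma seed_equivP (E E' : finGroupType) (W : autMod k E) (W' : autMod k E') :
  seed_equiv W W' <->
  exists Y : {group E * E'}, [/\ embeds Y, embeds (conv Y) &
    exists f : {linear W' -> W}, bijective f /\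
    forall a b, star (Delta_aut b) Y = star Y (Delta_aut a) ->
    forall w, f (am_act a w) = am_act b (f w)].
Proof.
split=> [[theta [iso [f [bij_f fP]]]] | [Y [eY eY' [f [bij_f fP]]]]].
  have [Y [eY eY' inY]] := embeds_isom iso; exists Y; split=> //.
  exists f; split=> // a b /(star_graph_aut _ _ inY) ab w; exact: fP.
have [theta [iso inY]] := embeds_graph eY (embeds_leq eY').
exists theta; split=> //; exists f; split=> // a b ab w; apply: fP.
by apply/(star_graph_aut _ _ inY).
Qed.

Lemma seed_equiv_refl (E : finGroupType) (W : autMod k E) : seed_equiv W W.
Proof.
apply/seed_equivP; exists (Delta E); rewrite conv_Delta.
split; [exact: embeds_Delta | exact: embeds_Delta | ].
exists (idfun : {linear W -> W}); split; first by exists id.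
by move=> a b; rewrite star_Deltal star_Deltar => /Delta_aut_inj ->.
Qed.

Lemma seed_equiv_sym (E E' : finGroupType) (W : autMod k E) (W' : autMod k E') :
  seed_equiv W W' -> seed_equiv W' W.
Proof.
move=> /seed_equivP[Y [eY eY' [f [bij_f fP]]]]; apply/seed_equivP.
exists (conv Y); rewrite convK; split=> //.
have f_inj := bij_inj bij_f.
have [g gf fg] := linear_inverse bij_f.
exists g; split; first by exists f.
move=> b a ba w; apply: f_inj; rewrite fg (fP a b) ?fg //.
have eYY : star Y (conv Y) = Delta E by move: eY'; rewrite /embeds convK.
rewrite -[star (Delta_aut b) Y]star_Deltal -{1}eYY -starA [star (conv Y) _]starA -ba.
by rewrite -starA eY star_Deltar.
Qed.

Lemma seed_equiv_trans (E1 E2 E3 : finGroupType) (W1 : autMod k E1)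
    (W2 : autMod k E2) (W3 : autMod k E3) :
  seed_equiv W1 W2 -> seed_equiv W2 W3 -> seed_equiv W1 W3.
Proof.
move=> /seed_equivP[Y [eY eY' [f [bij_f fP]]]] /seed_equivP[Z [eZ eZ' [g [bij_g gP]]]].
apply/seed_equivP; exists (star Y Z); rewrite conv_star; split; try exact: embeds_star.
exists (f \o g : {linear W3 -> W1}); split; first exact: bij_comp.
move=> a c ac w /=.
have eYY : star Y (conv Y) = Delta E1 by move: eY'; rewrite /embeds convK.
have [b bE] : exists b, star (conv Y) (star (Delta_aut c) Y) = Delta_aut b.
  have [|b ->] := @embeds_autP _ (star (conv Y) (star (Delta_aut c) Y)); last by exists b.
  by apply: embeds_star => //; apply: embeds_star => //; apply: embeds_Delta_aut.
rewrite (gP a b) ?(fP b c) //.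
  by rewrite -bE starA eYY star_Deltal.
by rewrite -bE -starA -starA ac starA starA eY star_Deltal.
Qed.

End SeedEquivalence.

Section Comparison.
Local Open Scope ring_scope.
Context (k : fieldType) (l : nat -> k) (hl : pos_monoid_hom l).
Context (I : choiceType) (K : I -> finGroupType).

(** The pairings of the maps [up] and [down] depend only on [W]. *)
Lemma extension_iso (M N : lamMod l K) (E : finGroupType) (W : autMod k E)
    (e : extension M W) (f : extension N W) :
  up_generated e -> down_separated e -> up_generated f -> down_separated f -> lam_iso M N.
Proof.
move=> gen_e sep_e gen_f sep_f.
have [||||g [g_inj gP]] := @pairing_embedding k W M N _ _ (ups e) (ups f) (downs e) (downs f).
- by [].
- by move=> v v0; apply: sep_e => i V; apply: (v0 (Tagged (fun i => {group E * K i}) V)).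
- by move=> v _ v0; apply: sep_f => i V; apply: (v0 (Tagged (fun i => {group E * K i}) V)).
- move=> [j U] [i V] w; rewrite /ups /downs /=.
  have [ij | /eqP ne] := eqVneq i j; last by rewrite !down_up_neq.
  by subst j; rewrite !down_up.
have gup i (U : {group K i * E}) w : g (up e U w) = up f U w.
  exact: (gP (Tagged (fun i => {group K i * E}) U)).
exists g; split.
  apply: bijectiveP => // n; have [xs ->] := gen_f n.
  exists (\sum_(x <- xs) ups e x.1 x.2); rewrite linear_sum.
  by apply: eq_bigr => x _; rewrite gP.
have g_sact i j (X : {group K i * K j}) m : g (sact M X m) = sact N X (g m).
  have [xs ->] := gen_e m; rewrite !linear_sum /=.
  apply: eq_bigr => -[[h U] w] _; rewrite /ups /= gup.
  have [jh | /eqP ne] := eqVneq j h; last by rewrite !sact_up_neq // linear0.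
  by subst h; rewrite !sact_up linearZ /= gup.
move=> x m; rewrite !lm_actE linear_sum; apply: eq_bigr => s _.
by rewrite linearZ /= g_sact.
Qed.

Lemma extension_along_iso (M N : lamMod l K) (E : finGroupType) (W : autMod k E) :
  lam_iso M N -> extension M W -> inhabited (extension N W).
Proof.
move=> [h [bij_h h_act]] e; have [h' hK h'K] := linear_inverse bij_h.
have h_sact i j (X : {group K i * K j}) m : h (sact M X m) = sact N X (h m).
  exact: h_act.
split; apply: (@Extension k l I K N E W (fun i U => h \o up e U) (fun i V => down e V \o h')).
- by move=> i j X U w; rewrite /= -h_sact sact_up linearZ.
- by move=> i j V X m; rewrite /= -[m in LHS]h'K -h_sact hK down_sact.
- by move=> i V U w; rewrite /= hK down_up.
Qed.

Lemma extension_transport (M : lamMod l K) (E E' : finGroupType) (W : autMod k E)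
    (W' : autMod k E') :
  seed_equiv W W' -> extension M W -> inhabited (extension M W').
Proof.
move=> /seed_equivP[Y [eY eY' [f [bij_f fP]]]] e.
have eYY : star Y (conv Y) = Delta E by move: eY'; rewrite /embeds convK.
have f_inj := bij_inj bij_f.
have [g _ fg] := linear_inverse bij_f.
pose up' i (U : {group K i * E'}) : {linear W' -> M} := up e (star U (conv Y)) \o f.
pose down' i (V : {group E' * K i}) : {linear M -> W'} := g \o down e (star Y V).
have f_grp X w : f (grp_act X w) = grp_act (star Y (star X (conv Y))) (f w).
  have [eX | neX] := pselect (embeds X).
    have [|b bE] := @embeds_autP _ (star Y (star X (conv Y))).
      by apply: embeds_star => //; apply: embeds_star.
    have [a aE] := embeds_autP eX; rewrite bE aE !grp_act_aut; apply: fP.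
    by rewrite -bE -aE -!starA eY star_Deltar.
  rewrite !grp_act_eq0 ?linear0 // => eYX; apply: neX.
  have -> : X = star (conv Y) (star (star Y (star X (conv Y))) Y).
    by rewrite -!starA eY star_Deltar starA eY star_Deltal.
  by apply: embeds_star => //; apply: embeds_star.
split; apply: (@Extension k l I K M E' W' up' down').
- move=> i j X U w; rewrite /up' /= sact_up starA; congr (_ *: _).
  by rewrite sigma_star_conv.
- move=> i j V X m; rewrite /down' /= down_sact linearZ /= starA; congr (_ *: _).
  by rewrite sigma_starl.
- move=> i V U w; rewrite /up' /down' /= down_up linearZ /=.
  rewrite sigma_starl // sigma_star_conv //; congr (_ *: _); apply: f_inj.
  by rewrite fg f_grp /= !starA.
Qed.

Section TwoSeeds.
Context (M : lamMod l K) (E E' : finGroupType) (W : autMod k E) (W' : autMod k E').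
Context (e : extension M W) (e' : extension M W').
Context (gen : up_generated e) (sep : down_separated e).
Context (gen' : up_generated e') (sep' : down_separated e').

(** [star A (conv A)] does not annihilate [M], which is spanned from [W']. Hence
    there are [V] and [U] such that [V], [A], [conv A] and [U] compose to an
    automorphism of [E'], and [star (conv A) U] presents [E'] as a section of [E]. *)
Lemma extension_embeds i (A : {group K i * E}) :
  embeds A -> (exists w : W, w != 0) -> exists Y : {group E * E'}, embeds Y.
Proof.
move=> eA [w w0].
have Aw0 : sact M (star A (conv A)) (up e A w) != 0.
  rewrite sact_up -starA eA star_Deltar scaler_eq0 (negPf (sigma_neq0 hl _ _)) /=.
  by apply: contra_neq w0 => /eqP; rewrite -(linear0 (up e A)) => /eqP/(up_embeds_inj hl eA).
have [[[j U] w']] : exists x, sact M (star A (conv A)) (ups e' x.1 x.2) != 0.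
  apply: contrapT => no; case/eqP: Aw0; have [xs ->] := gen' (up e A w).
  rewrite linear_sum big1 // => x _; apply/eqP/negPn/negP => nz.
  by apply: no; exists x.
rewrite /ups /=; have [ij | /eqP ne] := eqVneq i j; last by rewrite sact_up_neq // eqxx.
subst j; rewrite sact_up scaler_eq0 negb_or => /andP[_ nz].
have [j [V]] : exists j (V : {group E' * K j}),
    down e' V (up e' (star (star A (conv A)) U) w') != 0.
  apply: contrapT => no; case/eqP: nz; apply: sep' => j V.
  by apply/eqP/negPn/negP => nz; apply: no; exists j, V.
have [ij | /eqP ne] := eqVneq j i; last by rewrite down_up_neq // eqxx.
subst j; rewrite down_up scaler_eq0 negb_or => /andP[_ /grp_act_neq0].
by rewrite -starA starA => /embeds_starr eY; exists (star (conv A) U).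
Qed.

(** When [Y] is the graph of an isomorphism from [E'] to [E], the map goes from
    [W'] up into [M] and back down to [W]; the scalar normalises it. *)
Lemma extension_transfer i (A : {group K i * E}) (Y : {group E * E'}) :
  embeds A -> embeds (conv Y) ->
  exists g : {linear W' -> W}, forall j (X : {group K j * E}) w,
    up e X (g w) = up e' (star X Y) w.
Proof.
move=> eA eY.
exists ((sigma l (conv A) A)^-1 \*: (down e (conv A) \o up e' (star A Y))) => j X w /=.
rewrite linearZ /= (up_down hl) // sigma_embeds_conv // scale1r sact_up star_cancel //.
rewrite sigma_cancel // -[Y in sigma l X Y]convK sigma_embeds_conv //.
by rewrite mulr1 scalerA mulVf ?scale1r ?sigma_neq0.
Qed.

End TwoSeeds.

(** Each of [E] and [E'] is a section of the other, so they are isomorphic; the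
    transfers along an isomorphism and its inverse are inverse to each other. *)
Lemma extension_seed_equiv (M : lamMod l K) (E E' : finGroupType) (W : autMod k E)
    (W' : autMod k E') (e : extension M W) (e' : extension M W') i i'
    (A : {group K i * E}) (A' : {group K i' * E'}) :
  up_generated e -> down_separated e -> up_generated e' -> down_separated e' ->
  embeds A -> embeds A' -> (exists w : W, w != 0) -> (exists w : W', w != 0) ->
  seed_equiv W W'.
Proof.
move=> gen sep gen' sep' eA eA' W0 W0'.
have [Y eY] := extension_embeds e gen' sep' eA W0.
have [Z eZ] := extension_embeds e' gen sep eA' W0'.
have eY' := embeds_conv eY (embeds_leq eZ).
have eYY : star Y (conv Y) = Delta E by move: eY'; rewrite /embeds convK.
have [f fP] := extension_transfer e' gen sep eA eY'.
have eY'' : embeds (conv (conv Y)) by rewrite convK.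
have [g gP] := extension_transfer e gen' sep' eA' eY''.
apply/seed_equivP; exists Y; split=> //; exists f; split.
  exists g => w.
    by apply: (up_embeds_inj hl (e := e') eA'); rewrite gP fP -starA eY star_Deltar.
  by apply: (up_embeds_inj hl (e := e) eA); rewrite fP gP -starA eYY star_Deltar.
move=> a b ab w; apply: (up_embeds_inj hl (e := e) eA).
rewrite fP -!grp_act_aut !(up_grp_act hl) // !sigma_Delta_aut // !scale1r fP.
by rewrite -!starA ab.
Qed.

End Comparison.

(** * The seed of a simple module *)

Section Value.
Local Open Scope ring_scope.
Context (k : fieldType) (l : nat -> k) (hl : pos_monoid_hom l).
Context (I : choiceType) (K : I -> finGroupType).

(** In Goursat's lemma for an endomorphism of [E], a section of full order would
    make both factors, hence [X], invertible. *)
Lemma goursat_endo (E : finGroupType) (X : {group E * E}) :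
  ~ embeds X ->
  exists M N : {group E}, (N <| M)%g /\
    forall Q : finGroupType, [set: Q] \isog (M / N)%g ->
    (#|Q| < #|E|)%N /\
    exists (A : {group E * Q}) (B : {group Q * E}), embeds A /\ X = star A B.
Proof.
move=> neX; have [M [N [nMN goursatX]]] := goursat X.
exists M, N; split=> // Q isoQ; have [A [eA AX eB]] := goursatX Q isoQ.
split; last by exists A, (star (conv A) X).
rewrite ltnNge; apply/negP => leEQ; apply: neX; rewrite -AX.
by apply: embeds_star => //; have := embeds_conv eB leEQ; rewrite convK.
Qed.

Section ValueAt.
Context (M : lamMod l K) (i0 : I) (E : finGroupType) (A : {group K i0 * E}).
Context (eA : embeds A).

Let c := sigma l (conv A) A.

Let c_neq0 : c != 0.
Proof. exact: sigma_neq0. Qed.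

(** [star A (conv A)] acts as [c] times an idempotent, whose image this is. *)
Definition value_at (m : M) : Prop := sact M (star A (conv A)) m = c *: m.

Lemma value_at0 : value_at 0.
Proof. by rewrite /value_at linear0 scaler0. Qed.

Lemma value_at_lin (b : k) m n : value_at m -> value_at n -> value_at (b *: m + n).
Proof.
by rewrite /value_at => mP nP; rewrite linearP mP nP scalerDr !scalerA mulrC.
Qed.

Definition value : submodule M := Submodule value_at0 value_at_lin.

Lemma value_sact j (V : {group E * K j}) m : value (sact M (star A V) m).
Proof.
by rewrite /= /value_at sact_sact star_cancel // sigma_cancel // (sigma_embeds hl V eA) mulr1.
Qed.

Lemma value_lift (T : lmodType k) (h : {linear T -> M}) :
  (forall t, value (h t)) ->
  {g : {linear T -> submodule_type value} | forall t, sub_val (g t) = h t}.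
Proof.
move=> hP; apply: linear_lift; first exact: sub_val_inj.
by move=> t; have [u <-] := submodule_elt (hP t); exists u.
Qed.

Lemma value_sactZ (b : k) j (V : {group E * K j}) m :
  value ((b \*: sact M (star A V)) m).
Proof. exact/(submoduleZ (P := value))/value_sact. Qed.

(** The action of [X] on the value at [E], carried out inside [K i0]. *)
Definition value_op (X : {group E * E}) :
    {linear submodule_type value -> submodule_type value} :=
  sval (@value_lift _ (c^-1 \*: (sact M (star A (star X (conv A))) \o @sub_val k M value))
    (fun w => value_sactZ c^-1 (star X (conv A)) (sub_val w))).

Lemma value_opE X w :
  sub_val (value_op X w) = c^-1 *: sact M (star A (star X (conv A))) (sub_val w).
Proof. by rewrite /value_op; case: value_lift. Qed.

Lemma value_opM X Y w :
  value_op X (value_op Y w) = sigma l X Y *: value_op (star X Y) w.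
Proof.
apply: sub_val_inj; rewrite linearZ /= !value_opE linearZ /= sact_sact !scalerA.
rewrite starA star_cancel // sigma_cancel // sigma_starl // sigma_star_conv //.
by rewrite !starA; congr (_ *: _); rewrite mulrACA mulVf // mul1r mulrC.
Qed.

Lemma value_op_Delta w : value_op (Delta E) w = w.
Proof.
apply: sub_val_inj; rewrite value_opE star_Deltal.
by rewrite (sub_val_in w : value_at _) scalerA mulVf // scale1r.
Qed.

Lemma value_op_aut1 w : value_op (Delta_aut 1%g) w = w.
Proof. by rewrite Delta_aut1 value_op_Delta. Qed.

Lemma value_op_autM (a b : autg E) w :
  value_op (Delta_aut (b * a)%g) w = value_op (Delta_aut a) (value_op (Delta_aut b) w).
Proof. by rewrite value_opM -star_Delta_aut sigma_Delta_aut // scale1r. Qed.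

Definition value_mod : autMod k E :=
  AutMod (fun a => linearP (value_op (Delta_aut a))) value_op_aut1 value_op_autM.

Context (kill : forall (X : {group E * E}) m, ~ embeds X ->
  sact M (star A (star X (conv A))) m = 0).

Lemma value_op_grp_act X (w : value_mod) : value_op X w = grp_act X w.
Proof.
have [eX | neX] := pselect (embeds X).
  by have [a ->] := embeds_autP eX; rewrite grp_act_aut.
rewrite grp_act_eq0 //; apply: sub_val_inj.
by rewrite value_opE kill // scaler0 linear0.
Qed.

Definition value_up i (U : {group K i * E}) : {linear value_mod -> M} :=
  c^-1 \*: (sact M (star U (conv A)) \o @sub_val k M value).

Definition value_down i (V : {group E * K i}) : {linear M -> value_mod} :=
  sval (value_lift (value_sact V)).

Lemma value_downE i (V : {group E * K i}) m :
  sub_val (value_down V m) = sact M (star A V) m.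
Proof. by rewrite /value_down; case: value_lift. Qed.

Lemma value_extension : extension M value_mod.
Proof.
apply: (@Extension _ _ _ _ M E value_mod value_up value_down).
- move=> i j X U w; rewrite /value_up /= linearZ /= sact_sact starA.
  by rewrite sigma_star_conv // !scalerA mulrC.
- move=> i j V X m; apply: sub_val_inj; rewrite linearZ /= !value_downE.
  by rewrite sact_sact starA sigma_starl.
- move=> i V U w; apply: sub_val_inj; rewrite linearZ /= value_downE.
  rewrite -value_op_grp_act value_opE /value_up /= linearZ /= sact_sact.
  by rewrite sigma_starl // sigma_star_conv // !scalerA !starA mulrC.
Qed.

End ValueAt.
(** The least such order is that of the group of the seed; [embeds A] confines
    the groups [E] to the sections of members of the family. *)
Definition acts_through (M : lamMod l K) (n : nat) : Prop :=
  exists (E : finGroupType) i (A : {group K i * E}) j (B : {group E * K j}) m,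
    [/\ #|E| = n, embeds A & sact M (star A B) m != 0].

Lemma acts_through_min (M : lamMod l K) :
  (exists m : M, m != 0) -> exists2 n, acts_through M n &
    forall n', acts_through M n' -> (n <= n')%N.
Proof.
case=> m m0; have [n] : exists n, acts_through M n.
  have [x [_ xm]] := lm_idem m.
  have [s sm] : exists s : symb K, sact M (symb_grp s) m != 0.
    apply: contrapT => no; case/eqP: m0; rewrite -xm lm_actE /lext big1 // => s _.
    suff -> : sact M (symb_grp s) m = 0 by rewrite scaler0.
    by apply/eqP/negPn/negP => sm; apply: no; exists s.
  exists #|K (symb_l s)|, (K (symb_l s)), (symb_l s), (Delta _), (symb_r s), (symb_grp s), m.
  by split; rewrite ?star_Deltal //; apply: embeds_Delta.
elim/ltn_ind: n => n IH thru_n.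
have [[n' [lt_n' thru_n']] | min_n] :=
  pselect (exists n', (n' < n)%N /\ acts_through M n'); first exact: (IH n').
exists n => // n' thru_n'; rewrite leqNgt; apply/negP => lt_n'; apply: min_n.
by exists n'.
Qed.

(** When the order of [E] is minimal, subgroups of [E * E] that factor through
    smaller groups act as zero, which is what an extension by a module of the
    automorphism group requires. *)
Lemma simple_has_seed (M : lamMod l K) :
  lam_simple M ->
  exists (E : finGroupType) (W : autMod k E),
    [/\ aut_simple W, inhabited (extension M W)
     & exists i (A : {group K i * E}), embeds A].
Proof.
move=> sM; have [M0 _] := iffLR (lam_simpleP M) sM.
have [_ [E [i [A [j [B [m [<- eA AB0]]]]]]] min_E] := acts_through_min M0.
have kill (X : {group E * E}) n : ~ embeds X -> sact M (star A (star X (conv A))) n = 0.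
  move=> /goursat_endo[P [N [_ small]]]; apply/eqP/negPn/negP => nz.
  have isoQ : [set: subg_of (P / N)%G] \isog (P / N)%g.
    by rewrite isog_sym; apply: isog_subg.
  have [ltQ [C [D [eC XE]]]] := small _ isoQ.
  suff: acts_through M #|subg_of (P / N)%G| by move/min_E; rewrite leqNgt ltQ.
  exists (subg_of (P / N)%G), i, (star A C), i, (star D (conv A)), n.
  by split=> //; [exact: embeds_star | rewrite -starA (starA C) -XE].
have W0 : exists w : value_mod M eA, w != 0.
  have [w wE] := submodule_elt (value_sact eA B m); exists w.
  by apply: contraNneq AB0 => w0; rewrite -wE w0 linear0.
exists E, (value_mod M eA); have e := value_extension eA kill; split.
- exact: (simple_aut_simple hl e eA sM W0).
- by split.
- by exists i, A.
Qed.

End Value.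

(** * The model of the simple module of a seed *)

Section Model.
Local Open Scope ring_scope.
Context (k : fieldType) (l : nat -> k) (hl : pos_monoid_hom l).
Context (I : choiceType) (K : I -> finGroupType).
Context (E : finGroupType) (W : autMod k E).

Definition coindex : Type := {i : I & {group E * K i}}.
Definition coind i (V : {group E * K i}) : coindex := Tagged (fun i => {group E * K i}) V.

(** The function [V |-> down V (up U w)] on all subgroups [V] of the [E * K i],
    as it must be in any extension by [W]. *)
Definition gen_fun (a : {i : I & {group K i * E}}) (w : W) : coindex -> W := fun b =>
  match tag b =P tag a with
  | ReflectT e =>
      let V := ecast i {group E * K i} e (tagged b) in
      sigma l V (tagged a) *: grp_act (star V (tagged a)) w
  | ReflectF _ => 0
  end.

(** The action on the coinduced module, by right translation of the argument. *)
Definition op_fun (s : symb K) (phi : coindex -> W) : coindex -> W := fun b =>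
  match tag b =P symb_l s with
  | ReflectT e =>
      let V := ecast i {group E * K i} e (tagged b) in
      sigma l V (symb_grp s) *: phi (coind (star V (symb_grp s)))
  | ReflectF _ => 0
  end.

Lemma gen_funE i (U : {group K i * E}) (V : {group E * K i}) w :
  gen_fun (Tagged (fun i => {group K i * E}) U) w (coind V) =
  sigma l V U *: grp_act (star V U) w.
Proof. by rewrite /gen_fun /=; case: eqP => // e; rewrite (eq_axiomK e). Qed.

Lemma gen_fun_neq a w b : tag b <> tag a -> gen_fun a w b = 0.
Proof. by rewrite /gen_fun; case: eqP. Qed.

Lemma op_funE i j (X : {group K i * K j}) (V : {group E * K i}) phi :
  op_fun (Symb X) phi (coind V) = sigma l V X *: phi (coind (star V X)).
Proof. by rewrite /op_fun /=; case: eqP => // e; rewrite (eq_axiomK e). Qed.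

Lemma op_fun_neq s phi b : tag b <> symb_l s -> op_fun s phi b = 0.
Proof. by rewrite /op_fun; case: eqP. Qed.

Lemma fun_linE (c : k) (f g : coindex -> W) b : (c *: f + g) b = c *: f b + g b.
Proof. by []. Qed.

Lemma gen_fun_linear a : linear (gen_fun a).
Proof.
move=> c u v; apply/funext => -[i V]; rewrite fun_linE.
have [ij | ne] := pselect (i = tag a).
  case: a ij => j U /= ij; subst j; rewrite !gen_funE linearP scalerDr !scalerA.
  by rewrite mulrC.
by rewrite !gen_fun_neq // scaler0 addr0.
Qed.
HB.instance Definition _ a :=
  GRing.isLinear.Build k W (coindex -> W) *:%R (gen_fun a) (gen_fun_linear a).

Lemma op_fun_linear s : linear (op_fun s).
Proof.
move=> c u v; apply/funext => -[i V]; rewrite fun_linE.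
have [ij | ne] := pselect (i = symb_l s).
  case: s ij => i' j X /= ij; subst i'; rewrite !op_funE fun_linE scalerDr !scalerA.
  by rewrite mulrC.
by rewrite !op_fun_neq // scaler0 addr0.
Qed.
HB.instance Definition _ s :=
  GRing.isLinear.Build k (coindex -> W) (coindex -> W) *:%R (op_fun s) (op_fun_linear s).

Lemma fun0E b : (0 : coindex -> W) b = 0.
Proof. by []. Qed.

Lemma funZE (c : k) (f : coindex -> W) b : (c *: f) b = c *: f b.
Proof. by []. Qed.

Lemma op_gen i j (X : {group K i * K j}) (U : {group K j * E}) w :
  op_fun (Symb X) (gen_fun (Tagged (fun i => {group K i * E}) U) w) =
  sigma l X U *: gen_fun (Tagged (fun i => {group K i * E}) (star X U)) w.
Proof.
apply/funext => -[h V]; rewrite funZE.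
have [hi | ne] := pselect (h = i); last by rewrite op_fun_neq // gen_fun_neq // scaler0.
by subst h; rewrite op_funE !gen_funE !scalerA starA sigmaA.
Qed.

Lemma op_gen_neq s a w : symb_r s <> tag a -> op_fun s (gen_fun a w) = 0.
Proof.
move=> ne; apply/funext => -[h V]; rewrite fun0E.
have [hi | ne'] := pselect (h = symb_l s); last by rewrite op_fun_neq.
case: s ne hi => i j X /= ne hi; subst h.
by rewrite op_funE gen_fun_neq // scaler0.
Qed.

Lemma op_op (s t : symb K) phi :
  lext (fun r => op_fun r phi) (symb_mul l s t) = op_fun s (op_fun t phi).
Proof.
case: s t => i j X [j' h Y]; have [jj' | ne] := pselect (j = j'); last first.
  rewrite symb_mul_neq // linear0; apply/funext => -[g V]; rewrite fun0E.
  have [gi | ne'] := pselect (g = i); last by rewrite op_fun_neq.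
  by subst g; rewrite op_funE op_fun_neq // scaler0.
subst j'; rewrite symb_mulE linearZ /= lextU.
apply/funext => -[g V]; rewrite funZE.
have [gi | ne] := pselect (g = i); last by rewrite !op_fun_neq // scaler0.
by subst g; rewrite !op_funE !scalerA starA sigmaA.
Qed.

(** The model is the image of the induced module in the coinduced one. *)
Definition model : submodule (coindex -> W) := span_sub gen_fun.

Lemma gen_in_model a w : model (gen_fun a w).
Proof. exact: (spanned1 gen_fun). Qed.

Lemma op_in_model s phi : model phi -> model (op_fun s phi).
Proof.
case=> xs ->; rewrite linear_sum; apply: (submodule_sum (P := model)) => -[[j U] w] /=.
have [ej | ne] := pselect (symb_r s = j); last first.
  by rewrite op_gen_neq //; apply: (submodule0 model).
case: s ej => i j' X /= ej; subst j'; rewrite op_gen.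
exact/(submoduleZ (P := model))/gen_in_model.
Qed.

Definition fun_act (x : lam k K) (phi : coindex -> W) : coindex -> W :=
  lext (fun s => op_fun s phi) x.

Lemma fun_act_linear x : linear (fun_act x).
Proof.
move=> c u v; rewrite /fun_act /lext scaler_sumr -big_split /=; apply: eq_bigr => s _.
by rewrite linearP scalerDr !scalerA mulrC.
Qed.
HB.instance Definition _ x :=
  GRing.isLinear.Build k (coindex -> W) (coindex -> W) *:%R (fun_act x) (fun_act_linear x).

Lemma fun_act_in_model x phi : model phi -> model (fun_act x phi).
Proof.
move=> phi_in; apply: (submodule_sum (P := model)) => s.
exact/(submoduleZ (P := model))/op_in_model.
Qed.

Lemma fun_actA x y phi : fun_act (lam_mul l x y) phi = fun_act x (fun_act y phi).
Proof.
rewrite /fun_act [lam_mul l x y]/lam_mul linear_sum; apply: eq_bigr => s _.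
rewrite linear_sum [in RHS]/lext linear_sum scaler_sumr; apply: eq_bigr => t _ /=.
by rewrite [LHS]linearZ /= op_op -scalerA; congr (_ *: _); rewrite [RHS]linearZ.
Qed.

Lemma model_lift x :
  {g : {linear submodule_type model -> submodule_type model} |
    forall m, sub_val (g m) = fun_act x (sub_val m)}.
Proof.
apply: (linear_lift (h := fun_act x \o @sub_val k _ model)); first exact: sub_val_inj.
move=> m; have [u uE] := submodule_elt (fun_act_in_model x (sub_val_in m)).
by exists u; apply/esym.
Qed.

Definition model_act (x : lam k K) := sval (model_lift x).

Lemma model_actE x m : sub_val (model_act x m) = fun_act x (sub_val m).
Proof. by rewrite /model_act; case: model_lift. Qed.

Lemma model_act_linl m : linear (model_act^~ m).
Proof.
move=> c x y; apply: sub_val_inj; rewrite linearP /= !model_actE /fun_act.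
exact: linearP.
Qed.

Lemma model_actA x y m : model_act (lam_mul l x y) m = model_act x (model_act y m).
Proof. by apply: sub_val_inj; rewrite !model_actE fun_actA. Qed.

Lemma sum_lam_id_idem (r : seq I) : uniq r ->
  lam_mul l (\sum_(i <- r) lam_id k K i) (\sum_(i <- r) lam_id k K i) =
  \sum_(i <- r) lam_id k K i.
Proof.
move=> uniq_r; rewrite lam_mulE linear_sum; apply: eq_big_seq => i ri.
rewrite /= {2}/lam_id /bas lextU linear_sum (bigD1_seq i) //= {1}/lam_id /bas lextU.
rewrite symb_mulE star_Deltal sigma_Deltal //.
rewrite scale1r big1 ?addr0 // => j ne; rewrite /lam_id /bas lextU symb_mul_neq //= => ij.
by rewrite ij eqxx in ne.
Qed.

(** An element of the span involves finitely many groups of the family; the sum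
    of their identities fixes it. *)
Lemma model_idem (m : submodule_type model) :
  exists e : lam k K, lam_mul l e e = e /\ model_act e m = m.
Proof.
have [xs mE] := sub_val_in m; pose r := undup [seq tag x.1 | x <- xs].
exists (\sum_(i <- r) lam_id k K i); split; first by rewrite sum_lam_id_idem ?undup_uniq.
apply: sub_val_inj; rewrite model_actE mE linear_sum; apply: eq_big_seq => -[[i U] w] xin /=.
have ri : i \in r by rewrite mem_undup; apply/mapP; exists (Tagged (fun i => {group K i * E}) U, w).
rewrite /fun_act linear_sum (bigD1_seq i) ?undup_uniq //= /lam_id /bas lextU op_gen.
rewrite star_Deltal sigma_Deltal // scale1r big1 ?addr0 // => j ne.
by rewrite lextU op_gen_neq //= => ij; rewrite ij eqxx in ne.
Qed.

Definition model_mod : lamMod l K :=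
  LamMod model_act_linl (fun x => linearP (model_act x)) model_actA model_idem.

Lemma model_sact i j (X : {group K i * K j}) (m : model_mod) :
  sub_val (sact model_mod X m) = op_fun (Symb X) (sub_val m).
Proof. by rewrite /sact /= model_actE /fun_act lextU. Qed.

Lemma model_up_lift i (U : {group K i * E}) :
  {g : {linear W -> submodule_type model} |
    forall w, sub_val (g w) = gen_fun (Tagged (fun i => {group K i * E}) U) w}.
Proof.
apply: (linear_lift (h := gen_fun (Tagged (fun i => {group K i * E}) U))).
  exact: sub_val_inj.
move=> w.
have [u uE] := submodule_elt (gen_in_model (Tagged (fun i => {group K i * E}) U) w).
by exists u; apply/esym.
Qed.

Definition model_up i (U : {group K i * E}) : {linear W -> model_mod} :=
  sval (model_up_lift U).

Lemma model_upE i (U : {group K i * E}) w :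
  sub_val (model_up U w) = gen_fun (Tagged (fun i => {group K i * E}) U) w.
Proof. by rewrite /model_up; case: model_up_lift. Qed.

Definition model_down i (V : {group E * K i}) (m : model_mod) : W :=
  sub_val m (coind V).

Lemma model_down_linear i (V : {group E * K i}) : linear (model_down V).
Proof. by move=> c u v; rewrite /model_down linearP. Qed.
HB.instance Definition _ i (V : {group E * K i}) :=
  GRing.isLinear.Build k model_mod W *:%R (model_down V) (model_down_linear V).

Definition model_extension : extension model_mod W.
Proof.
apply: (@Extension _ _ _ _ model_mod E W model_up model_down).
- move=> i j X U w; apply: sub_val_inj.
  by rewrite model_sact linearZ /= !model_upE op_gen.
- by move=> i j V X m; rewrite /= /model_down model_sact op_funE.
- by move=> i V U w; rewrite /= /model_down model_upE gen_funE.
Defined.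

Lemma model_generated : up_generated model_extension.
Proof.
move=> m; have [xs mE] := sub_val_in m; exists xs; apply: sub_val_inj.
rewrite linear_sum mE; apply: eq_bigr => -[[i U] w] _.
by rewrite /ups /= model_upE.
Qed.

Lemma model_separated : down_separated model_extension.
Proof.
move=> m m0; apply: sub_val_inj; rewrite linear0; apply/funext => -[i V].
by have := m0 i V; rewrite /= /model_down.
Qed.

End Model.

(** * Realization in a larger family *)

Section SelfValue.
Local Open Scope ring_scope.
Context (k : fieldType) (l : nat -> k) (hl : pos_monoid_hom l).
Context (I : choiceType) (K : I -> finGroupType).

(** If [X] is not an automorphism, it factors through a proper section of [K x],
    where a module that is minimal at [x] vanishes. *)
Lemma minimal_at_kill (M : lamMod l K) x :
  subquotient_closed K -> minimal_at M x ->
  forall (X : {group K x * K x}) m, ~ embeds X -> sact M X m = 0.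
Proof.
move=> closedK [_ minx] X m /goursat_endo[P [N [nNP small]]].
have [j isoj] := closedK x P N nNP; have [ltj [A [B [eA XE]]]] := small _ isoj.
apply/eqP/negPn/negP => Xm.
have /card_isog : [set: K j] \isog [set: K x].
  apply: minx; first by exists P, N.
  exists (sact M B m); split; first by exists (sact M B m); apply/esym/(sact_Delta hl).
  apply: contraNneq Xm => Bm; rewrite XE -[sact M _ m]scale1r.
  by rewrite -(sigma_embeds hl B eA) -sact_sact Bm linear0.
by rewrite !cardsT => ej; rewrite ej ltnn in ltj.
Qed.

Section Object.
Context (M : lamMod l K) (x : I) (W : autMod k (K x)) (e : extension M W).
Context (gen : up_generated e) (sep : down_separated e).

Lemma in_evalP i m : in_eval i m <-> sact M (Delta (K i)) m = m.
Proof.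
split=> [[n ->] | <-]; last by exists m.
exact: sact_Delta.
Qed.

(** If [M] does not vanish at [K j], then it is spanned there by images of maps
    [up e U] with [U] an embedding, so [K x] is a section of [K j]. *)
Lemma extension_minimal_at : (exists w : W, w != 0) -> minimal_at M x.
Proof.
case=> w w0; split.
  exists (up e (Delta (K x)) w); split; first by apply/in_evalP; apply: sact_Delta_up.
  apply: contra_neq w0 => /eqP; rewrite -(linear0 (up e (Delta (K x)))) => /eqP.
  by apply: up_embeds_inj => //; apply: embeds_Delta.
move=> j /factor_group_embeds[B /embeds_leq lejx] [m [/in_evalP mE m0]].
have [U eU] : exists U : {group K j * K x}, embeds U.
  apply: contrapT => noU; case/eqP: m0; apply: sep => i V; rewrite -mE.
  have [xs ->] := gen m; rewrite !linear_sum big1 // => -[[h U] u] _ /=.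
  rewrite /ups /=; have [jh | /eqP ne] := eqVneq j h; last by rewrite sact_up_neq // linear0.
  subst h; rewrite sact_Delta_up //; have [ij | /eqP ne] := eqVneq i j; last by rewrite down_up_neq.
  subst i; rewrite down_up grp_act_eq0 ?scaler0 // => /embeds_starr eU.
  by apply: noU; exists U.
have [theta [iso _]] := embeds_graph eU lejx.
by rewrite isog_sym; apply: isom_isog iso; rewrite subxx.
Qed.

(** The value of [M] at [K x] is the image of [up e (Delta (K x))], as all other
    maps [up] into it factor through this one. *)
Lemma extension_iso_Res_mu : iso_Res_mu W M.
Proof.
exists (up e (Delta (K x))); split; first split.
- by apply: up_embeds_inj => //; apply: embeds_Delta.
- move=> m; rewrite in_evalP; split=> [<- | [w ->]]; last exact: sact_Delta_up.
  have [xs ->] := gen m; rewrite linear_sum.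
  pose F (y : {i : I & {group K i * K x}} * W) : W :=
    down e (Delta (K x)) (ups e y.1 y.2).
  exists (\sum_(y <- xs) F y); rewrite linear_sum; apply: eq_bigr => y _.
  by rewrite /F (up_down hl) // sigma_Deltal // scale1r star_Deltal.
- move=> a w; rewrite -grp_act_aut (up_grp_act hl) // sigma_Deltal // scale1r.
  rewrite -[RHS]/(sact M (Delta_aut a) _) sact_up sigma_Deltar // scale1r.
  by rewrite star_Deltal star_Deltar.
Qed.

End Object.
End SelfValue.

Section Realization.
Local Open Scope ring_scope.
Context (k : fieldType) (l : nat -> k) (hl : pos_monoid_hom l).
Context (I J : choiceType) (K : I -> finGroupType) (L : J -> finGroupType).

Lemma lam_inclE (x : lam k K) : lam_incl L x = lext (fun s => << symb_incl L s >>) x.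
Proof. by []. Qed.

Definition incl_act (M : lamMod l (extend K L)) i j (X : {group K i * K j}) :
    {linear M -> M} :=
  @sact k l _ (extend K L) M (inl i) (inl j) X.

Lemma lm_act_incl (M : lamMod l (extend K L)) (x : lam k K) (m : M) :
  lm_act (lam_incl L x) m = lext (fun s => incl_act M (symb_grp s) m) x.
Proof.
rewrite lm_actE lam_inclE [in LHS]/(lext _ x) linear_sum; apply: eq_bigr => s _.
by rewrite linearZ /= lextU.
Qed.

Lemma lm_act_incl_bas (M : lamMod l (extend K L)) i j (X : {group K i * K j}) (m : M) :
  lm_act (lam_incl L (bas k X)) m = incl_act M X m.
Proof. by rewrite lm_act_incl lextU. Qed.

(** The maps [up] and [down] are the actions on [M] of the subgroups between
    [extend K L x] and the groups of the smaller family. Minimality of [M] at [x]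
    makes the endomorphisms that are not automorphisms act as zero. *)
Lemma realization_extension (S : lamMod l K) (M : lamMod l (extend K L)) (x : I + J)
    (W : autMod k (extend K L x)) :
  subquotient_closed (extend K L) -> minimal_at M x -> iso_Res_mu W M ->
  iso_Lam_span S M -> inhabited (extension S W).
Proof.
move=> closed minx [f [[f_inj fP] f_aut]] [g [[g_inj gP] g_act]].
have g_sact i j (X : {group K i * K j}) m : g (sact S X m) = incl_act M X (g m).
  by rewrite /sact /= g_act lm_act_incl_bas.
pose a i (U : {group K i * extend K L x}) : {linear M -> M} :=
  @sact k l _ (extend K L) M (inl i) x U.
pose b i (V : {group extend K L x * K i}) : {linear M -> M} :=
  @sact k l _ (extend K L) M x (inl i) V.
have up_onto i (U : {group K i * extend K L x}) w : exists m, (a i U \o f) w = g m.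
  apply/gP; exists [:: (bas k (Delta (K i)), a i U (f w))].
  by rewrite big_seq1 lm_act_incl_bas /incl_act /a sact_Delta.
have down_onto i (V : {group extend K L x * K i}) m : exists w, (b i V \o g) m = f w.
  by apply/fP/(in_evalP hl); rewrite /= /b sact_Delta.
pose up' i (U : {group K i * extend K L x}) := sval (linear_lift g_inj (up_onto i U)).
pose down' i (V : {group extend K L x * K i}) := sval (linear_lift f_inj (down_onto i V)).
have upE i (U : {group K i * extend K L x}) w : g (up' i U w) = a i U (f w).
  by rewrite /up'; case: linear_lift => h /= ->.
have downE i (V : {group extend K L x * K i}) m : f (down' i V m) = b i V (g m).
  by rewrite /down'; case: linear_lift => h /= ->.
split; apply: (@Extension _ _ _ _ S (extend K L x) W up' down').
- move=> i j X U w; apply: (g_inj _ _); rewrite linearZ /= g_sact !upE.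
  by rewrite /incl_act /a sact_sact.
- move=> i j V X m; apply: (f_inj _ _); rewrite linearZ /= !downE g_sact.
  by rewrite /incl_act /b sact_sact.
move=> i V U w; apply: (f_inj _ _); rewrite linearZ /= downE upE /a /b sact_sact.
congr (_ *: _); have [eVU | neVU] := pselect (embeds (star V U)).
  by have [c ->] := embeds_autP eVU; rewrite grp_act_aut f_aut.
by rewrite grp_act_eq0 // linear0 (minimal_at_kill hl closed minx).
Qed.

(** Both [S] and the span of [M] under the smaller algebra are generated by images
    of [W], and the pairings of the generators are determined by [W] alone. *)
Lemma extension_iso_Lam_span (S : lamMod l K) (M : lamMod l (extend K L))
    (E : finGroupType) (W : autMod k E) (e : extension S W) (f : extension M W) :
  up_generated e -> down_separated e -> up_generated f -> down_separated f ->
  iso_Lam_span S M.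
Proof.
move=> gen_e sep_e gen_f sep_f.
pose p (a : {i : I & {group K i * E}}) : {linear W -> M} :=
  @up _ _ _ _ _ _ _ f (inl (tag a)) (tagged a).
pose q (b : {i : I & {group E * K i}}) : {linear M -> W} :=
  @down _ _ _ _ _ _ _ f (inl (tag b)) (tagged b).
have [||||g [g_inj gP]] := @pairing_embedding k W S M _ _ (ups e) p (downs e) q.
- by [].
- by move=> v v0; apply: sep_e => i V; apply: (v0 (Tagged (fun i => {group E * K i}) V)).
- move=> v [xs vE] v0; apply: sep_f => -[i | j] V.
    exact: (v0 (Tagged (fun i => {group E * K i}) V)).
  by rewrite vE linear_sum big1 // => y _; rewrite down_up_neq.
- move=> [j U] [i V] w; rewrite /ups /downs /p /q /=.
  have [ij | /eqP ne] := eqVneq i j; last first.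
    by rewrite !down_up_neq // => -[].
  by subst j; rewrite !down_up.
have gup i (U : {group K i * E}) w : g (up e U w) = @up _ _ _ _ _ _ _ f (inl i) U w.
  exact: (gP (Tagged (fun i => {group K i * E}) U)).
have g_sact i j (X : {group K i * K j}) m : g (sact S X m) = incl_act M X (g m).
  have [xs ->] := gen_e m; rewrite !linear_sum /=.
  apply: eq_bigr => -[[h U] w] _; rewrite /ups /= gup /incl_act.
  have [jh | /eqP ne] := eqVneq j h; last by rewrite !sact_up_neq ?linear0 // => -[].
  by subst h; rewrite !sact_up linearZ /= gup.
have g_act x m : g (lm_act x m) = lm_act (lam_incl L x) (g m).
  rewrite lm_act_incl lm_actE linear_sum; apply: eq_bigr => s _.
  by rewrite linearZ /= g_sact.
exists g; split=> //; split=> // u.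
have img_lin (c : k) v w : (exists s, v = g s) -> (exists s, w = g s) -> exists s, c *: v + w = g s.
  by move=> [s ->] [t ->]; exists (c *: s + t); rewrite linearP.
have img0 : exists s, 0 = g s by exists 0; rewrite linear0.
pose img := Submodule img0 img_lin.
split=> [[xs ->] | [s ->]].
  apply: (submodule_sum (P := img)) => -[x m] /=; rewrite lm_act_incl.
  apply: (submodule_sum (P := img)) => -[i j X] /=.
  apply: (submoduleZ (P := img)).
  have [ys ->] := gen_f m; rewrite linear_sum; apply: (submodule_sum (P := img)) => -[[h U] w].
  rewrite /ups /= /incl_act; have [jh | ne] := pselect (inl j = h); last first.
    by rewrite sact_up_neq //; apply: (submodule0 img).
  subst h; rewrite sact_up; apply: (submoduleZ (P := img)); exists (up e (star X U) w).
  by rewrite gup.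
have [xs ->] := gen_e s; rewrite linear_sum.
exists [seq (bas k (Delta (K (tag y.1))), g (ups e y.1 y.2)) | y <- xs].
rewrite big_map; apply: eq_bigr => -[[i U] w] _.
by rewrite /= -g_act -[lm_act _ _]/(sact S (Delta (K i)) _) /ups /= sact_Delta_up.
Qed.

End Realization.

Section Universal.
Local Open Scope group_scope.

Definition cayley (gT : finGroupType) (g : gT) (r : 'I_#|gT|) : 'I_#|gT| :=
  enum_rank (enum_val r * g).

Lemma cayley_inj (gT : finGroupType) (g : gT) : injective (cayley g).
Proof. by move=> r s /enum_rank_inj/mulIg/enum_val_inj. Qed.

Lemma isog_perm_group (gT : finGroupType) (G : {group gT}) :
  exists n (H : {group 'S_n}), G \isog H.
Proof.
pose rho g := perm (@cayley_inj gT g).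
have rhoM : {in G &, {morph rho : x y / x * y}}.
  by move=> x y _ _; apply/permP => r; rewrite permM !permE /cayley enum_rankK mulgA.
exists #|gT|, (Morphism rhoM @* G)%G; apply: sub_isog => //.
apply/injmP => x y _ _ /permP/(_ (enum_rank 1)).
by rewrite !permE /cayley => /enum_rank_inj; rewrite enum_rankK !mul1g.
Qed.

(** By Cayley's theorem the permutation groups represent all finite groups; [E]
    itself is included so that no transport of seeds is needed. *)
Definition with_all_groups (E : finGroupType) (j : {n : nat & {group 'S_n}} + unit) :
    finGroupType :=
  match j with inl u => subg_of (tagged u) | inr _ => E end.

Lemma with_all_groups_closed (I : choiceType) (K : I -> finGroupType) (E : finGroupType) :
  subquotient_closed (extend K (with_all_groups E)).
Proof.
move=> i M N _; have [n [H isoH]] := isog_perm_group (M / N)%G.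
exists (inr (inl (Tagged (fun n => {group 'S_n}) H))) => /=.
by rewrite (isog_transl _ (isog_symr (isog_subg H))) isog_sym.
Qed.

End Universal.

Section Correspondence.
Local Open Scope ring_scope.
Context (k : fieldType) (l : nat -> k) (hl : pos_monoid_hom l).
Context (I : choiceType) (K : I -> finGroupType).

(** The model over the enlarged family serves as [S'], with [E] as the minimal
    group. *)
Lemma simple_iso_S (S : lamMod l K) (E : finGroupType) (W : autMod k E)
    (e : extension S W) i (A : {group K i * E}) :
  lam_simple S -> aut_simple W -> embeds A -> iso_S S W.
Proof.
move=> sS sW eA; have [W0 _] := sW.
pose K' := extend K (with_all_groups E).
pose x : I + ({n : nat & {group 'S_n}} + unit) := inr (inr tt).
exists _, (with_all_groups E); split; first exact: with_all_groups_closed.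
exists x, W; split=> //; split; first exact: seed_equiv_refl.
pose M := @model_mod k l hl _ K' E W.
pose f : extension M W := model_extension hl K' W.
have gen_f : up_generated f by apply: model_generated.
have sep_f : down_separated f by apply: model_separated.
have eD : @embeds (K' x) E (Delta E) by apply: embeds_Delta.
exists M; split.
- exact: (nondegenerate_simple hl gen_f sep_f (i0 := x) eD).
- exact: (@extension_minimal_at _ _ hl _ K' M x W f).
- exact: (@extension_iso_Res_mu _ _ hl _ K' M x W f).
- apply: (extension_iso_Lam_span hl (e := e) (f := f)) => //.
    exact: (simple_generated hl e eA sS W0).
  exact: (simple_separated hl (e := e) eA sS W0).
Qed.

Lemma seed_embeds (s : seed k K) : exists i (A : {group K i * sd_grp s}), embeds A.
Proof.
by have [i /factor_group_embeds[A eA]] := sd_factor s; exists i, A.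
Qed.

Lemma iso_S_seed (S : lamMod l K) (s : seed k K) :
  iso_S S (sd_mod s) -> inhabited (extension S (sd_mod s)).
Proof.
case=> J [L [closed [x [W [sW [sW_equiv [M [sM minx res span]]]]]]]].
have [e] := realization_extension hl closed minx res span.
exact: (extension_transport hl (seed_equiv_sym sW_equiv)).
Qed.

End Correspondence.

Theorem theorem3p5 (k : fieldType) (char0 : [pchar k]%R =i pred0)
    (l : nat -> k) (hl : pos_monoid_hom l)
    (I : choiceType) (hI : inhabited I) (K : I -> finGroupType) :
  class_bijection
    (fun S T : simpleMod l K => lam_iso S T)
    (fun s t : seed k K => seed_equiv (sd_mod s) (sd_mod t))
    (fun (S : simpleMod l K) (s : seed k K) => iso_S S (sd_mod s)).
Proof.
split.
- move=> S S' s s' [h [bij_h h_act]] ss' [J [L [closed [x [W [sW [sW_eq [M]]]]]]]].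
  case=> sM minx res [g [[g_inj gP] g_act]].
  exists J, L; split=> //; exists x, W; split=> //; split.
    exact: (seed_equiv_trans (seed_equiv_sym ss')).
  exists M; split=> //.
  have [h' hK' hK] := linear_inverse bij_h.
  exists (g \o h' : {linear S' -> M}); split; first split.
  + by move=> m n /g_inj/(congr1 h); rewrite !hK.
  + move=> u; rewrite gP; split=> -[m ->]; first by exists (h m); rewrite /= hK'.
    by exists (h' m).
  + by move=> y m /=; rewrite -g_act; congr (g _); apply: (bij_inj bij_h); rewrite h_act !hK.
- move=> S; have [E [W [sW [e] [i [A eA]]]]] := simple_has_seed hl (sm_simple S).
  have factW : exists i, factor_group E (K i).
    by exists i; apply/factor_group_embeds; exists A.
  exists (Seed factW sW); exact: (simple_iso_S hl e (sm_simple S) sW eA).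
- move=> s; have [i [A eA]] := seed_embeds s; have sW := sd_simple s.
  have sM : lam_simple (model_mod hl K (sd_mod s)).
    have gen : up_generated (model_extension hl K (sd_mod s)) by apply: model_generated.
    have sep : down_separated (model_extension hl K (sd_mod s)) by apply: model_separated.
    exact: (nondegenerate_simple hl gen sep eA sW).
  exists (SimpleMod sM); exact: (simple_iso_S hl (model_extension hl K _) sM sW eA).
move=> S S' s s' /(iso_S_seed hl)[e] /(iso_S_seed hl)[e'].
have [i [A eA]] := seed_embeds s; have [i' [A' eA']] := seed_embeds s'.
have [W0 _] := sd_simple s; have [W0' _] := sd_simple s'.
have gen := simple_generated hl e eA (sm_simple S) W0.
have sep := simple_separated hl (e := e) eA (sm_simple S) W0.
have gen' := simple_generated hl e' eA' (sm_simple S') W0'.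
have sep' := simple_separated hl (e := e') eA' (sm_simple S') W0'.
split=> [iso | /seed_equiv_sym eqv].
  have [f] := extension_along_iso iso e.
  have gen_f := simple_generated hl f eA (sm_simple S') W0.
  have sep_f := simple_separated hl (e := f) eA (sm_simple S') W0.
  exact: (extension_seed_equiv hl gen_f sep_f gen' sep' eA eA').
have [f] := extension_transport hl eqv e'.
have gen_f := simple_generated hl f eA (sm_simple S') W0.
have sep_f := simple_separated hl (e := f) eA (sm_simple S') W0.
exact: (extension_iso hl gen sep gen_f sep_f).
Qed.
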